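(* Let $\mathcal B$ be a pretriangulated dg category. Then the cofibrations and weak equivalences of closed morphisms (as defined in the context) make the cycle category $\mathcal Z(\mathcal B)$ into a stable cofibration category in which every object is fibrant. Moreover, the homotopy category $\mathbf{Ho}(\mathcal Z(\mathcal B))$ is equivalent, as a triangulated category, to the homology category $\mathbf H(\mathcal B)$. In particular, every algebraic triangulated category is a topological triangulated category.
   Context: **Dg categories.** A dg category $\mathcal B$ is a category enriched in chain complexes of abelian groups (homological grading). A $\mathcal B$-module $M$ is a covariant dg functor from $\mathcal B$ to chain complexes of abelian groups; it is representable if there are an object $Y$ and a $0$-cycle $u\in M(Y)_0$ (the universal $0$-cycle) such that $\mathcal B(Y,Z)\to M(Z)$, $\varphi\mapsto\varphi\cdot u$, is an isomorphism of complexes for every $Z$. A closed morphism $f:X\to Y$ is a $0$-cycle in $\mathcal B(X,Y)$. $\mathcal B$ is pretriangulated if it has a zero object and: (a) for every object $X$ and integer $m$ the module $\mathcal B(X,-)[m]$, with $(\mathcal B(X,Z)[m])_{m+k}=\mathcal B(X,Z)_k$, $d(f[m])=(-1)^m(df)[m]$, $\varphi\cdot(\psi[m])=(-1)^{m|\varphi|}(\varphi\psi)[m]$, is representable; (b) for every closed morphism $f:X\to Y$ the module $M$ with $M(Z)_k=\mathcal B(Y,Z)_k\oplus\mathcal B(X,Z)_{k+1}$, $d(a,b)=(d(a),af-d(b))$, $\varphi\cdot(a,b)=(\varphi a,(-1)^{|\varphi|}\varphi b)$, is representable; a representing object is a mapping cone $Cf$. The cycle category $\mathcal Z(\mathcal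 B)$ has the same objects and the closed morphisms as morphisms; the homology category $\mathbf H(\mathcal B)$ has the same objects and $\mathbf H(\mathcal B)(X,Y)=H_0(\mathcal B(X,Y))$. For pretriangulated $\mathcal B$, $\mathbf H(\mathcal B)$ is triangulated: the shift $X[1]$ represents $\mathcal B(X,-)[-1]$, and distinguished triangles are those isomorphic to the image of $X\xrightarrow{f}Y\xrightarrow{i}Cf\xrightarrow{\bar p}X[1]$ for a closed morphism $f$, where $(i,u)\in\mathcal B(Y,Cf)_0\oplus\mathcal B(X,Cf)_1$ is the universal $0$-cycle, $p\in\mathcal B(Cf,X)_{-1}$ is the cycle with $p\cdot(i,u)=(0,1_X)$, and $\bar p$ is the closed morphism corresponding to $p$ (its composite with the universal degree-1 element in $\mathcal B(X,X[1])_1$). A triangulated category is algebraic if it is equivalent, as a triangulated category, to $\mathbf H(\mathcal B)$ for some pretriangulated $\mathcal B$. **The two classes of morphisms in $\mathcal Z(\mathcal B)$.** A closed morphism is a weak equivalence if it becomes an isomorphism in $\mathbf H(\mathcal B)$. A closed morphism $i:A\to B$ is a cofibration if for every object $Z$ the chain map $\mathcal B(i,Z):\mathcal B(B,Z)\to\mathcal B(A,Z)$ is surjective and the kernel $\mathcal B$-module $Z\mapsto\ker[\mathcal B(i,Z)]$ is representable. **Cofibration categories.** A cofibration category is a category $\mathcal C$ with classes of cofibrations and weak equivalences such that: (C1) all isomorphisms are cofibrations and weak equivalences; cofibrations are stable under composition; $\mathcal C$ has an initial object and every morphism from an initial object is a cofibration; (C2) if two of $f,g,gf$ are weak equivalences,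 so is the third; (C3) for a cofibration $i:A\to B$ and any morphism $f:A\to C$ there is a pushout $P$ of $B\xleftarrow{i}A\xrightarrow{f}C$, the morphism $j:C\to P$ is a cofibration, and $j$ is a weak equivalence if $i$ is; (C4) every morphism factors as a cofibration followed by a weak equivalence. An acyclic cofibration is a cofibration that is a weak equivalence. An object is fibrant if every acyclic cofibration out of it has a retraction. $\gamma:\mathcal C\to\mathbf{Ho}(\mathcal C)$ is the localization at the weak equivalences (identity on objects). **Stability and triangulation.** $\mathcal C$ is pointed if every initial object is also terminal (zero object $\ast$). For every object $A$ choose a cone, i.e. a cofibration $i_A:A\to CA$ with $CA\to\ast$ a weak equivalence; $p:CA\to\Sigma A=CA/A$ is the quotient. For $\alpha:A\to B$ choose a cone extension: a morphism $\bar\alpha:CA\to\bar C$ and an acyclic cofibration $s:CB\to\bar C$ with $\bar\alpha i_A=si_B\alpha$ and such that $CA\cup_ACB\to\bar C$ is a cofibration; $\Sigma\alpha=\gamma(s/B)^{-1}\gamma(\bar\alpha/\alpha)$ (independent of choices). This induces $\Sigma:\mathbf{Ho}(\mathcal C)\to\mathbf{Ho}(\mathcal C)$. For a cofibration $j:A\to B$ with quotient $q:B\to B/A$ let $\delta(j)=\gamma(p\cup0)\gamma(0\cup q)^{-1}:B/A\to\Sigma A$, where $p\cup 0:CA\cup_AB\to\Sigma A$ collapses $B$ and the weak equivalence $0\cup q:CA\cup_AB\to B/A$ collapses $CA$. Distinguished triangles are those isomorphic to $A\xrightarrow{\gamma(j)}B\xrightarrow{\gamma(q)}B/A\xrightarrow{\delta(j)}\Sigma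 A$ for a cofibration $j$. $\mathcal C$ is stable if it is pointed and $\Sigma$ is an autoequivalence of $\mathbf{Ho}(\mathcal C)$; then $\mathbf{Ho}(\mathcal C)$ is triangulated by this structure. A triangulated category is topological if it is equivalent, as a triangulated category, to $\mathbf{Ho}(\mathcal C)$ for a stable cofibration category $\mathcal C$. *)

(* Defs.v *)
From HB Require Import structures.
From mathcomp Require Import all_boot all_order all_algebra.
From Stdlib Require Import RelationClasses.

Set Implicit Arguments.
Unset Strict Implicit.
Unset Printing Implicit Defensive.
Import GRing.Theory.
Local Open Scope ring_scope.

Declare Scope cat_scope.
Delimit Scope cat_scope with cat.

(******************************************************************************)
(*   Categories.  Hom-types carry an equivalence relation [~=], which plays   *)
(* the role of equality of morphisms.  Homology categories and localizations  *)
(* are then obtained by changing the relation, without quotient types.        *)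
(******************************************************************************)

Record category := Category {
  ob :> Type;
  hom : ob -> ob -> Type;
  eqm : forall A B, hom A B -> hom A B -> Prop;
  idm : forall A, hom A A;
  cmp : forall A B C, hom B C -> hom A B -> hom A C;
  eqm_equiv : forall A B, Equivalence (@eqm A B);
  cmp_eqm : forall A B C (g g' : hom B C) (f f' : hom A B),
    eqm g g' -> eqm f f' -> eqm (cmp g f) (cmp g' f');
  cmp_id_l : forall A B (f : hom A B), eqm (cmp (idm B) f) f;
  cmp_id_r : forall A B (f : hom A B), eqm (cmp f (idm A)) f;
  cmp_assoc : forall A B C D (h : hom C D) (g : hom B C) (f : hom A B),
    eqm (cmp h (cmp g f)) (cmp (cmp h g) f) }.

Arguments hom {c}.
Arguments eqm {c A B}.
Arguments idm {c}.
Arguments cmp {c A B C}.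

Notation "f ~= g" := (eqm f g) (at level 70, no associativity) : cat_scope.
Notation "g \o f" := (cmp g f) : cat_scope.
Local Open Scope cat_scope.

Record functor (C D : category) := Functor {
  fob :> C -> D;
  fmap : forall A B, hom A B -> hom (fob A) (fob B);
  fmap_eqm : forall A B (f g : hom A B), f ~= g -> fmap f ~= fmap g;
  fmap_id : forall A, fmap (idm A) ~= idm (fob A);
  fmap_cmp : forall A B E (g : hom B E) (f : hom A B),
    fmap (g \o f) ~= fmap g \o fmap f }.

Arguments fmap {C D} _ {A B} _.

Lemma functor_id_proof (C : category) (A B : C) (f : hom A B) : f ~= f.
Proof. exact: (@reflexivity _ _ (@Equivalence_Reflexive _ _ (eqm_equiv A B))). Qed.

Definition functor_id (C : category) : functor C C :=
  @Functor C C id (fun A B f => f) (fun A B f g e => e)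
    (fun A => functor_id_proof (idm A))
    (fun A B E g f => functor_id_proof (g \o f)).

Section FunctorComp.
Variables (C D E : category) (G : functor D E) (F : functor C D).

Let fc_map (A B : C) (f : hom A B) : hom (G (F A)) (G (F B)) :=
  fmap G (fmap F f).

Lemma functor_comp_eqm A B (f g : hom A B) : f ~= g -> fc_map f ~= fc_map g.
Proof. by move=> e; do 2!apply: fmap_eqm. Qed.

Lemma functor_comp_id A : fc_map (idm A) ~= idm (G (F A)).
Proof.
have [_ _ tr] := eqm_equiv (G (F A)) (G (F A)).
by apply: (tr _ (fmap G (idm (F A)))); [apply/fmap_eqm/fmap_id | apply: fmap_id].
Qed.

Lemma functor_comp_cmp A B K (g : hom B K) (f : hom A B) :
  fc_map (g \o f) ~= fc_map g \o fc_map f.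
Proof.
have [_ _ tr] := eqm_equiv (G (F A)) (G (F K)).
by apply: tr (fmap_cmp G _ _); apply/fmap_eqm/fmap_cmp.
Qed.

Definition functor_comp : functor C E :=
  @Functor C E (fun A => G (F A)) fc_map functor_comp_eqm functor_comp_id
    functor_comp_cmp.

End FunctorComp.

Definition are_inverse (C : category) (A B : C) (f : hom A B) (g : hom B A) :=
  g \o f ~= idm A /\ f \o g ~= idm B.

Definition is_iso (C : category) (A B : C) (f : hom A B) : Prop :=
  exists g : hom B A, are_inverse f g.

Record nat_iso (C D : category) (F G : functor C D) := NatIso {
  nt :> forall A : C, hom (F A) (G A);
  nt_iso : forall A, is_iso (nt A);
  nt_nat : forall (A B : C) (f : hom A B), nt B \o fmap F f ~= fmap G f \o nt A }.

Definition is_equivalence (C D : category) (F : functor C D) : Prop :=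
  exists G : functor D C,
    inhabited (nat_iso (functor_comp G F) (functor_id C)) /\
    inhabited (nat_iso (functor_comp F G) (functor_id D)).

Section BasicNotions.
Variable C : category.

Definition is_initial (X : C) : Prop :=
  forall Y, exists f : hom X Y, forall g : hom X Y, g ~= f.

Definition is_terminal (X : C) : Prop :=
  forall Y, exists f : hom Y X, forall g : hom Y X, g ~= f.

Definition is_zero_ob (X : C) : Prop := is_initial X /\ is_terminal X.

Definition is_zero_mor (X Y : C) (f : hom X Y) : Prop :=
  exists (Z : C) (a : hom X Z) (b : hom Z Y), is_zero_ob Z /\ f ~= b \o a.

(* The square            i
                     A -----> B
                   f |        | k
                     v        v
                     C0 ----> P
                          j                  *)
Definition is_pushout (A B C0 P : C) (i : hom A B) (f : hom A C0)
    (k : hom B P) (j : hom C0 P) : Prop :=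
  k \o i ~= j \o f /\
  forall (Q : C) (k' : hom B Q) (j' : hom C0 Q), k' \o i ~= j' \o f ->
    exists2 u : hom P Q, u \o k ~= k' /\ u \o j ~= j' &
      forall u' : hom P Q, u' \o k ~= k' -> u' \o j ~= j' -> u' ~= u.

(* [q] exhibits [Q] as B/A, the pushout of B <-j- A -> * *)
Definition is_quotient (A B Q : C) (j : hom A B) (q : hom B Q) : Prop :=
  exists (Z : C) (a : hom A Z) (z : hom Z Q), is_zero_ob Z /\ is_pushout j a q z.

(* h = u^-1 v *)
Definition is_left_quotient (X Y Z : C) (u : hom Y Z) (v : hom X Z)
    (h : hom X Y) : Prop := is_iso u /\ u \o h ~= v.

(* h = v u^-1 *)
Definition is_right_quotient (X Y Z : C) (v : hom X Z) (u : hom X Y)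
    (h : hom Y Z) : Prop := is_iso u /\ h \o u ~= v.

End BasicNotions.

Record tri_data := TriData {
  tri_cat :> category;
  shift : functor tri_cat tri_cat;
  dist : forall X Y Z : tri_cat, hom X Y -> hom Y Z -> hom Z (shift X) -> Prop }.

Arguments shift {t}.
Arguments dist {t X Y Z}.

Definition tri_iso (C : category) (S : functor C C)
    (X Y Z X' Y' Z' : C)
    (f : hom X Y) (g : hom Y Z) (h : hom Z (S X))
    (f' : hom X' Y') (g' : hom Y' Z') (h' : hom Z' (S X')) : Prop :=
  exists (a : hom X X') (b : hom Y Y') (c : hom Z Z'),
    [/\ is_iso a, is_iso b & is_iso c] /\
    [/\ b \o f ~= f' \o a, c \o g ~= g' \o b & fmap S a \o h ~= h' \o c].

(* The additive structure of a category is recorded as abelian group laws on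
   the hom-sets; for an additive category these laws are unique. *)
Record additive_structure (C : category) := AdditiveStructure {
  addm : forall A B : C, hom A B -> hom A B -> hom A B;
  zerom : forall A B : C, hom A B;
  oppm : forall A B : C, hom A B -> hom A B;
  addm_eqm : forall (A B : C) (f f' g g' : hom A B),
    f ~= f' -> g ~= g' -> addm f g ~= addm f' g';
  addm_assoc : forall (A B : C) (f g h : hom A B),
    addm f (addm g h) ~= addm (addm f g) h;
  addm_comm : forall (A B : C) (f g : hom A B), addm f g ~= addm g f;
  addm_zero : forall (A B : C) (f : hom A B), addm (zerom A B) f ~= f;
  addm_opp : forall (A B : C) (f : hom A B), addm (oppm f) f ~= zerom A B;
  cmp_addm_l : forall (A B D : C) (g g' : hom B D) (f : hom A B),
    addm g g' \o f ~= addm (g \o f) (g' \o f);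
  cmp_addm_r : forall (A B D : C) (g : hom B D) (f f' : hom A B),
    g \o addm f f' ~= addm (g \o f) (g \o f');
  has_zero_ob : exists Z : C, is_zero_ob Z;
  has_biproducts : forall X Y : C,
    exists (P : C) (i1 : hom X P) (i2 : hom Y P) (p1 : hom P X) (p2 : hom P Y),
    [/\ p1 \o i1 ~= idm X, p2 \o i2 ~= idm Y, p1 \o i2 ~= zerom Y X,
        p2 \o i1 ~= zerom X Y & addm (i1 \o p1) (i2 \o p2) ~= idm P] }.

Record triangulated_axioms (T : tri_data) (Ad : additive_structure T) : Prop := {
  shift_equivalence : is_equivalence (@shift T);
  shift_additive : forall (X Y : T) (f g : hom X Y),
    fmap shift (addm Ad f g) ~= addm Ad (fmap shift f) (fmap shift g);
  dist_iso : forall (X Y Z X' Y' Z' : T)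
    (f : hom X Y) (g : hom Y Z) (h : hom Z (shift X))
    (f' : hom X' Y') (g' : hom Y' Z') (h' : hom Z' (shift X')),
    dist f g h -> tri_iso f g h f' g' h' -> dist f' g' h';
  dist_id : forall X Z : T, is_zero_ob Z ->
    dist (idm X) (zerom Ad X Z) (zerom Ad Z (shift X));
  dist_complete : forall (X Y : T) (f : hom X Y),
    exists (Z : T) (g : hom Y Z) (h : hom Z (shift X)), dist f g h;
  dist_rotate : forall (X Y Z : T)
    (f : hom X Y) (g : hom Y Z) (h : hom Z (shift X)),
    dist f g h <-> dist g h (oppm Ad (fmap shift f));
  dist_fill : forall (X Y Z X' Y' Z' : T)
    (f : hom X Y) (g : hom Y Z) (h : hom Z (shift X))
    (f' : hom X' Y') (g' : hom Y' Z') (h' : hom Z' (shift X'))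
    (a : hom X X') (b : hom Y Y'),
    dist f g h -> dist f' g' h' -> b \o f ~= f' \o a ->
    exists c : hom Z Z', c \o g ~= g' \o b /\ fmap shift a \o h ~= h' \o c;
  dist_octahedral : forall (X Y Z U V W : T) (f : hom X Y) (g : hom Y Z)
    (f1 : hom Y U) (f2 : hom U (shift X))
    (g1 : hom Z V) (g2 : hom V (shift Y))
    (k1 : hom Z W) (k2 : hom W (shift X)),
    dist f f1 f2 -> dist g g1 g2 -> dist (g \o f) k1 k2 ->
    exists (a : hom U W) (b : hom W V),
      [/\ dist a b (fmap shift f1 \o g2),
          a \o f1 ~= k1 \o g, k2 \o a ~= f2, b \o k1 ~= g1 &
          g2 \o b ~= fmap shift f \o k2] }.

Definition triangulated (T : tri_data) : Prop :=
  exists Ad : additive_structure T, triangulated_axioms Ad.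

(* Triangles are required to be preserved and reflected, which makes the
   relation visibly symmetric; between triangulated categories an equivalence
   commuting with the shifts that preserves triangles also reflects them. *)
Definition tri_equivalent (T T' : tri_data) : Prop :=
  exists2 F : functor T T', is_equivalence F &
  exists tau : nat_iso (functor_comp F (@shift T)) (functor_comp (@shift T') F),
    forall (X Y Z : T) (f : hom X Y) (g : hom Y Z) (h : hom Z (shift X)),
      dist f g h <-> dist (fmap F f) (fmap F g) (tau X \o fmap F h).

(******************************************************************************)
(*   Localization: C[W^-1], with the objects of C, presented by generators    *)
(* (morphisms of C and formal inverses of the morphisms in W) and relations.  *)
(******************************************************************************)

Section Localization.
Variables (C : category) (W : forall A B : C, hom A B -> Prop).

Inductive loc_hom : C -> C -> Type :=
| loc_of A B : hom A B -> loc_hom A B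
| loc_inv A B (w : hom A B) : W w -> loc_hom B A
| loc_cmp A B D : loc_hom B D -> loc_hom A B -> loc_hom A D.

Inductive loc_eq : forall A B, loc_hom A B -> loc_hom A B -> Prop :=
| loc_eq_refl A B (f : loc_hom A B) : loc_eq f f
| loc_eq_sym A B (f g : loc_hom A B) : loc_eq f g -> loc_eq g f
| loc_eq_trans A B (f g h : loc_hom A B) :
    loc_eq f g -> loc_eq g h -> loc_eq f h
| loc_eq_cmp A B D (g g' : loc_hom B D) (f f' : loc_hom A B) :
    loc_eq g g' -> loc_eq f f' -> loc_eq (loc_cmp g f) (loc_cmp g' f')
| loc_eq_assoc A B D E (h : loc_hom D E) (g : loc_hom B D) (f : loc_hom A B) :
    loc_eq (loc_cmp h (loc_cmp g f)) (loc_cmp (loc_cmp h g) f)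
| loc_eq_id_l A B (f : loc_hom A B) : loc_eq (loc_cmp (loc_of (idm B)) f) f
| loc_eq_id_r A B (f : loc_hom A B) : loc_eq (loc_cmp f (loc_of (idm A))) f
| loc_eq_of A B (f g : hom A B) : f ~= g -> loc_eq (loc_of f) (loc_of g)
| loc_eq_of_cmp A B D (g : hom B D) (f : hom A B) :
    loc_eq (loc_of (g \o f)) (loc_cmp (loc_of g) (loc_of f))
| loc_eq_inv_l A B (w : hom A B) (Ww : W w) :
    loc_eq (loc_cmp (loc_inv Ww) (loc_of w)) (loc_of (idm A))
| loc_eq_inv_r A B (w : hom A B) (Ww : W w) :
    loc_eq (loc_cmp (loc_of w) (loc_inv Ww)) (loc_of (idm B)).

Lemma loc_eq_equiv A B : Equivalence (@loc_eq A B).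
Proof.
split; [exact: loc_eq_refl | exact: loc_eq_sym | exact: loc_eq_trans].
Qed.

Definition localization : category :=
  @Category C loc_hom loc_eq (fun A => loc_of (idm A)) loc_cmp
    loc_eq_equiv loc_eq_cmp loc_eq_id_l loc_eq_id_r loc_eq_assoc.

Definition loc_functor : functor C localization :=
  @Functor C localization id loc_of loc_eq_of
    (fun A => loc_eq_refl (loc_of (idm A))) loc_eq_of_cmp.

End Localization.

Record cof_data := CofData {
  cof_cat :> category;
  cof : forall A B : cof_cat, hom A B -> Prop;
  weq : forall A B : cof_cat, hom A B -> Prop }.

Arguments cof {c A B}.
Arguments weq {c A B}.

Record cofibration_category (C : cof_data) : Prop := {
  cof_eqm : forall (A B : C) (f g : hom A B), f ~= g -> cof f -> cof g;
  weq_eqm : forall (A B : C) (f g : hom A B), f ~= g -> weq f -> weq g;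
  iso_cof : forall (A B : C) (f : hom A B), is_iso f -> cof f;
  iso_weq : forall (A B : C) (f : hom A B), is_iso f -> weq f;
  cof_cmp : forall (A B D : C) (g : hom B D) (f : hom A B),
    cof g -> cof f -> cof (g \o f);
  has_initial : exists X : C, is_initial X;
  initial_cof : forall (X Y : C) (f : hom X Y), is_initial X -> cof f;
  weq_cmp : forall (A B D : C) (g : hom B D) (f : hom A B),
    weq f -> weq g -> weq (g \o f);
  weq_cancel_l : forall (A B D : C) (g : hom B D) (f : hom A B),
    weq g -> weq (g \o f) -> weq f;
  weq_cancel_r : forall (A B D : C) (g : hom B D) (f : hom A B),
    weq f -> weq (g \o f) -> weq g;
  cof_pushout : forall (A B D : C) (i : hom A B) (f : hom A D), cof i ->
    exists (P : C) (k : hom B P) (j : hom D P),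
      [/\ is_pushout i f k j, cof j & weq i -> weq j];
  cof_weq_factor : forall (A B : C) (f : hom A B),
    exists (D : C) (i : hom A D) (w : hom D B),
      [/\ cof i, weq w & f ~= w \o i] }.

Definition fibrant (C : cof_data) (X : C) : Prop :=
  forall (Y : C) (i : hom X Y), cof i -> weq i ->
    exists r : hom Y X, r \o i ~= idm X.

Definition pointed (C : cof_data) : Prop :=
  forall X : C, is_initial X -> is_terminal X.

Definition Ho (C : cof_data) : category := localization (@weq C).
Definition gamma (C : cof_data) : functor C (Ho C) := loc_functor (@weq C).
Arguments gamma {C}.

Record cone_of (C : cof_data) (A : C) := ConeOf {
  cone : C;
  cone_in : hom A cone;
  susp : C;
  cone_proj : hom cone susp;
  cone_cof : cof cone_in;
  cone_contractible :
    exists2 Z : C, is_zero_ob Z & exists w : hom cone Z, weq w;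
  cone_quotient : is_quotient cone_in cone_proj }.

Arguments cone {C A}.
Arguments cone_in {C A}.
Arguments susp {C A}.
Arguments cone_proj {C A}.

Definition is_cone_extension (C : cof_data) (A B : C) (KA : cone_of A)
    (KB : cone_of B) (al : hom A B)
    (D : C) (al' : hom (cone KA) D) (s : hom (cone KB) D) : Prop :=
  [/\ cof s, weq s, al' \o cone_in KA ~= s \o (cone_in KB \o al) &
      exists (P : C) (k : hom (cone KA) P) (j : hom (cone KB) P) (u : hom P D),
        is_pushout (cone_in KA) (cone_in KB \o al) k j /\
        [/\ u \o k ~= al', u \o j ~= s & cof u]].

(* A choice of cones together with the resulting suspension functor on Ho(C).
   The functor is pinned down by [susp_map_gamma], i.e. Sigma(gamma(al)) =
   gamma(s/B)^-1 gamma(al'/al) for every cone extension (al', s) of al; here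
   [q : D -> D/B] is the quotient by the composite B -> CB -> D, and
   [alq : CA/A -> D/B], [sq : CB/B -> D/B] are the maps induced by al', s. *)
Record suspension (C : cof_data) := Suspension {
  susp_cone : forall A : C, cone_of A;
  susp_map : forall A B : C, @hom (Ho C) A B ->
    @hom (Ho C) (susp (susp_cone A)) (susp (susp_cone B));
  susp_map_eqm : forall (A B : C) (f g : @hom (Ho C) A B),
    f ~= g -> susp_map f ~= susp_map g;
  susp_map_id : forall A : C,
    susp_map (@idm (Ho C) A) ~= @idm (Ho C) (susp (susp_cone A));
  susp_map_cmp : forall (A B D : C) (g : @hom (Ho C) B D) (f : @hom (Ho C) A B),
    susp_map (g \o f) ~= susp_map g \o susp_map f;
  susp_map_gamma : forall (A B D Q : C) (al : hom A B)
    (al' : hom (cone (susp_cone A)) D) (s : hom (cone (susp_cone B)) D)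
    (q : hom D Q)
    (alq : hom (susp (susp_cone A)) Q) (sq : hom (susp (susp_cone B)) Q),
    is_cone_extension al al' s ->
    is_quotient (s \o cone_in (susp_cone B)) q ->
    alq \o cone_proj (susp_cone A) ~= q \o al' ->
    sq \o cone_proj (susp_cone B) ~= q \o s ->
    is_left_quotient (fmap gamma sq) (fmap gamma alq) (susp_map (fmap gamma al)) }.

Definition susp_functor (C : cof_data) (S : suspension C) :
    functor (Ho C) (Ho C) :=
  @Functor (Ho C) (Ho C) (fun A => susp (susp_cone S A)) (@susp_map C S)
    (@susp_map_eqm C S) (@susp_map_id C S) (@susp_map_cmp C S).

(* A suspension is unique up to natural isomorphism, so it does not matter for
   which choice of cones it is required to be an equivalence. *)
Definition stable (C : cof_data) : Prop :=
  [/\ pointed C, inhabited (suspension C) &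
      forall S : suspension C, is_equivalence (susp_functor S)].

(* de = gamma(p u 0) gamma(0 u q)^-1 : B/A -> Sigma A *)
Definition is_connecting (C : cof_data) (A B Q : C) (KA : cone_of A)
    (j : hom A B) (q : hom B Q) (de : @hom (Ho C) Q (susp KA)) : Prop :=
  exists (P : C) (k : hom (cone KA) P) (l : hom B P)
         (p0 : hom P (susp KA)) (q0 : hom P Q),
    [/\ is_pushout (cone_in KA) j k l,
        p0 \o k ~= cone_proj KA /\ is_zero_mor (p0 \o l),
        is_zero_mor (q0 \o k) /\ q0 \o l ~= q &
        is_right_quotient (fmap gamma p0) (fmap gamma q0) de].

Definition Ho_tri (C : cof_data) (S : suspension C) : tri_data :=
  @TriData (Ho C) (susp_functor S)
    (fun X Y Z f g h =>
      exists (A B Q : C) (j : hom A B) (q : hom B Q)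
             (de : @hom (Ho C) Q (susp (susp_cone S A))),
        [/\ cof j, is_quotient j q, is_connecting j q de &
            @tri_iso _ (susp_functor S) A B Q X Y Z
              (fmap gamma j) (fmap gamma q) de f g h]).

(******************************************************************************)
(*   Dg categories.  The degree of a composite or a differential is a free    *)
(* index constrained by an equation (e.g. [k = m + n]), so that the axioms    *)
(* need no transport along equalities of degrees.                             *)
(******************************************************************************)

Record dg_cat := DgCat {
  dg_ob :> Type;
  dhom : dg_ob -> dg_ob -> int -> zmodType;
  dd : forall X Y (m n : int), m = n + 1 -> dhom X Y m -> dhom X Y n;
  did : forall X, dhom X X 0;
  dcmp : forall X Y Z (m n k : int), k = m + n ->
    dhom Y Z m -> dhom X Y n -> dhom X Z k;
  ddD : forall X Y m n (e : m = n + 1) (f g : dhom X Y m),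
    dd e (f + g) = dd e f + dd e g;
  ddd : forall X Y m n k (e : m = n + 1) (e' : n = k + 1) (f : dhom X Y m),
    dd e' (dd e f) = 0;
  dcmpDl : forall X Y Z m n k (e : k = m + n)
    (g g' : dhom Y Z m) (f : dhom X Y n),
    dcmp e (g + g') f = dcmp e g f + dcmp e g' f;
  dcmpDr : forall X Y Z m n k (e : k = m + n)
    (g : dhom Y Z m) (f f' : dhom X Y n),
    dcmp e g (f + f') = dcmp e g f + dcmp e g f';
  dcmp1l : forall X Y m (e : m = 0 + m) (f : dhom X Y m), dcmp e (did Y) f = f;
  dcmp1r : forall X Y m (e : m = m + 0) (f : dhom X Y m), dcmp e f (did X) = f;
  dcmpA : forall W X Y Z a b c ab bc abc
    (e1 : bc = b + c) (e2 : abc = a + bc) (e3 : ab = a + b) (e4 : abc = ab + c)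
    (h : dhom Y Z a) (g : dhom X Y b) (f : dhom W X c),
    dcmp e2 h (dcmp e1 g f) = dcmp e4 (dcmp e3 h g) f;
  ddM : forall X Y Z m n k m' n' k' (e : k = m + n)
    (ek : k = k' + 1) (em : m = m' + 1) (en : n = n' + 1)
    (el : k' = m' + n) (er : k' = m + n') (g : dhom Y Z m) (f : dhom X Y n),
    dd ek (dcmp e g f)
      = dcmp el (dd em g) f + dcmp er g (dd en f) *~ (-1) ^ m }.

Arguments dhom {d}.
Arguments dd {d X Y m n}.
Arguments did {d}.
Arguments dcmp {d X Y Z m n k}.

(* covariant dg functors from B to chain complexes, in the form of an action *)
Record dg_module (B : dg_cat) := DgModule {
  mhom :> B -> int -> zmodType;
  md : forall X (m n : int), m = n + 1 -> mhom X m -> mhom X n;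
  mact : forall X Y (m n k : int), k = m + n ->
    dhom X Y m -> mhom X n -> mhom Y k;
  mdD : forall X m n (e : m = n + 1) (x y : mhom X m),
    md e (x + y) = md e x + md e y;
  mdd : forall X m n k (e : m = n + 1) (e' : n = k + 1) (x : mhom X m),
    md e' (md e x) = 0;
  mactDl : forall X Y m n k (e : k = m + n)
    (f f' : dhom X Y m) (x : mhom X n),
    mact e (f + f') x = mact e f x + mact e f' x;
  mactDr : forall X Y m n k (e : k = m + n)
    (f : dhom X Y m) (x x' : mhom X n),
    mact e f (x + x') = mact e f x + mact e f x';
  mact1 : forall X m (e : m = 0 + m) (x : mhom X m), mact e (did X) x = x;
  mactA : forall X Y Z a b c ab bc abc
    (e1 : bc = b + c) (e2 : abc = a + bc) (e3 : ab = a + b) (e4 : abc = ab + c)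
    (g : dhom Y Z a) (f : dhom X Y b) (x : mhom X c),
    mact e2 g (mact e1 f x) = mact e4 (dcmp e3 g f) x;
  mdM : forall X Y m n k m' n' k' (e : k = m + n)
    (ek : k = k' + 1) (em : m = m' + 1) (en : n = n' + 1)
    (el : k' = m' + n) (er : k' = m + n') (f : dhom X Y m) (x : mhom X n),
    md ek (mact e f x) = mact el (dd em f) x + mact er f (md en x) *~ (-1) ^ m }.

Arguments md {B} d {X m n}.
Arguments mact {B} d {X Y m n k}.

(* By [rep_cycle] and [mdM] the maps phi |-> phi . rep_u commute with the
   differentials; they form an isomorphism of complexes since they are bijective
   in every degree. *)
Record representation (B : dg_cat) (M : dg_module B) := Representation {
  rep_ob : B;
  rep_u : M rep_ob 0;
  rep_cycle : forall n (e : 0 = n + 1), md M e rep_u = 0;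
  rep_inv : forall (Z : B) (k : int), M Z k -> dhom rep_ob Z k;
  rep_invK : forall Z k (e : k = k + 0) (x : M Z k),
    mact M e (rep_inv x) rep_u = x;
  rep_actK : forall Z k (e : k = k + 0) (f : dhom rep_ob Z k),
    rep_inv (mact M e f rep_u) = f }.

Arguments rep_ob {B M}.
Arguments rep_u {B M}.
Arguments rep_inv {B M} r {Z k}.

Definition representable (B : dg_cat) (M : dg_module B) : Prop :=
  inhabited (representation M).

Section DgLemmas.
Variable B : dg_cat.

Lemma dd0 (X Y : B) m n (e : m = n + 1) : dd e (0 : dhom X Y m) = 0.
Proof. by apply: (addrI (dd e 0)); rewrite -ddD !addr0. Qed.
Lemma ddN (X Y : B) m n (e : m = n + 1) (f : dhom X Y m) : dd e (- f) = - dd e f.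
Proof. by apply/eqP; rewrite -addr_eq0 -ddD addNr dd0. Qed.
Lemma ddZ (X Y : B) m n (e : m = n + 1) (f : dhom X Y m) a :
  dd e (f *~ a) = dd e f *~ a.
Proof.
have nat b : dd e (f *+ b) = dd e f *+ b.
  by elim: b => [|b IH]; rewrite ?dd0 // !mulrS ddD IH.
by case: a => b; rewrite ?NegzE ?mulrNz -!pmulrn ?ddN nat.
Qed.

Lemma dcmp0l (X Y Z : B) m n k (e : k = m + n) (f : dhom X Y n) :
  dcmp e (0 : dhom Y Z m) f = 0.
Proof. by apply: (addrI (dcmp e 0 f)); rewrite -dcmpDl !addr0. Qed.
Lemma dcmpNl (X Y Z : B) m n k (e : k = m + n) (g : dhom Y Z m) (f : dhom X Y n) :
  dcmp e (- g) f = - dcmp e g f.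
Proof. by apply/eqP; rewrite -addr_eq0 -dcmpDl addNr dcmp0l. Qed.
Lemma dcmpZl (X Y Z : B) m n k (e : k = m + n) (g : dhom Y Z m) (f : dhom X Y n) a :
  dcmp e (g *~ a) f = dcmp e g f *~ a.
Proof.
have nat b : dcmp e (g *+ b) f = dcmp e g f *+ b.
  by elim: b => [|b IH]; rewrite ?dcmp0l // !mulrS dcmpDl IH.
by case: a => b; rewrite ?NegzE ?mulrNz -!pmulrn ?dcmpNl nat.
Qed.

Lemma dcmp0r (X Y Z : B) m n k (e : k = m + n) (g : dhom Y Z m) :
  dcmp e g (0 : dhom X Y n) = 0.
Proof. by apply: (addrI (dcmp e g 0)); rewrite -dcmpDr !addr0. Qed.
Lemma dcmpNr (X Y Z : B) m n k (e : k = m + n) (g : dhom Y Z m) (f : dhom X Y n) :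
  dcmp e g (- f) = - dcmp e g f.
Proof. by apply/eqP; rewrite -addr_eq0 -dcmpDr addNr dcmp0r. Qed.
Lemma dcmpZr (X Y Z : B) m n k (e : k = m + n) (g : dhom Y Z m) (f : dhom X Y n) a :
  dcmp e g (f *~ a) = dcmp e g f *~ a.
Proof.
have nat b : dcmp e g (f *+ b) = dcmp e g f *+ b.
  by elim: b => [|b IH]; rewrite ?dcmp0r // !mulrS dcmpDr IH.
by case: a => b; rewrite ?NegzE ?mulrNz -!pmulrn ?dcmpNr nat.
Qed.

End DgLemmas.

Lemma sgnD (m n : int) : (-1 : int) ^ (m + n) = (-1) ^ m * (-1) ^ n.
Proof. by rewrite exprzDr. Qed.

Lemma sgn_sq (a : int) : (-1 : int) ^ a * (-1) ^ a = 1.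
Proof. by rewrite -exprMz_comm ?mulrN1 ?opprK ?exp1rz //; exact: mulrC. Qed.

Lemma sgnK (V : zmodType) (x : V) (a : int) : x *~ (-1) ^ a *~ (-1) ^ a = x.
Proof. by rewrite -mulrzA sgn_sq mulr1z. Qed.

(* B(X,-)[m]: the element f[m] of degree m + k is encoded by f in degree k, so
   the degree k part is B(X,Z)_(k - m). *)
Section ShiftModule.
Variables (B : dg_cat) (X : B) (m : int).

Definition shift_mhom (Z : B) (k : int) : zmodType := dhom X Z (k - m).

Lemma shift_deg_d (a b : int) : a = b + 1 -> a - m = b - m + 1.
Proof. by move->; rewrite addrAC. Qed.

Lemma shift_deg_act (a b k : int) : k = a + b -> k - m = a + (b - m).
Proof. by move->; rewrite addrA. Qed.

Definition shift_md (Z : B) (a b : int) (e : a = b + 1) (f : shift_mhom Z a) :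
    shift_mhom Z b :=
  dd (shift_deg_d e) f *~ (-1) ^ m.

Definition shift_mact (Y Z : B) (a b k : int) (e : k = a + b) (g : dhom Y Z a)
    (f : shift_mhom Y b) : shift_mhom Z k :=
  dcmp (shift_deg_act e) g f *~ (-1) ^ (m * a).

Lemma shift_mdD Z a b (e : a = b + 1) (x y : shift_mhom Z a) :
  shift_md e (x + y) = shift_md e x + shift_md e y.
Proof. by rewrite /shift_md ddD mulrzDl. Qed.

Lemma shift_mdd Z a b c (e : a = b + 1) (e' : b = c + 1) (x : shift_mhom Z a) :
  shift_md e' (shift_md e x) = 0.
Proof. by rewrite /shift_md ddZ ddd !mul0rz. Qed.

Lemma shift_mactDl Y Z a b k (e : k = a + b) (f f' : dhom Y Z a)
    (x : shift_mhom Y b) :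
  shift_mact e (f + f') x = shift_mact e f x + shift_mact e f' x.
Proof. by rewrite /shift_mact dcmpDl mulrzDl. Qed.

Lemma shift_mactDr Y Z a b k (e : k = a + b) (f : dhom Y Z a)
    (x x' : shift_mhom Y b) :
  shift_mact e f (x + x') = shift_mact e f x + shift_mact e f x'.
Proof. by rewrite /shift_mact dcmpDr mulrzDl. Qed.

Lemma shift_mact1 Y a (e : a = 0 + a) (x : shift_mhom Y a) :
  shift_mact e (did Y) x = x.
Proof. by rewrite /shift_mact mulr0 expr0z mulr1z dcmp1l. Qed.

Lemma shift_mactA U Y Z a b c ab bc abc
    (e1 : bc = b + c) (e2 : abc = a + bc) (e3 : ab = a + b) (e4 : abc = ab + c)
    (g : dhom Y Z a) (f : dhom U Y b) (x : shift_mhom U c) :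
  shift_mact e2 g (shift_mact e1 f x) = shift_mact e4 (dcmp e3 g f) x.
Proof.
rewrite /shift_mact dcmpZr -mulrzA.
have -> : (-1 : int) ^ (m * ab) = (-1) ^ (m * b) * (-1) ^ (m * a).
  by rewrite e3 mulrDr sgnD mulrC.
by congr (_ *~ _); apply: dcmpA.
Qed.

Lemma shift_mdM Y Z a b k a' b' k' (e : k = a + b)
    (ek : k = k' + 1) (ea : a = a' + 1) (eb : b = b' + 1)
    (el : k' = a' + b) (er : k' = a + b') (f : dhom Y Z a) (x : shift_mhom Y b) :
  shift_md ek (shift_mact e f x)
    = shift_mact el (dd ea f) x + shift_mact er f (shift_md eb x) *~ (-1) ^ a.
Proof.
rewrite /shift_md /shift_mact ddZ dcmpZr.
rewrite (ddM _ _ ea (shift_deg_d eb) (shift_deg_act el) (shift_deg_act er)).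
rewrite !mulrzDl -!mulrzA; congr (_ *~ _ + _ *~ _).
  have -> : (-1 : int) ^ (m * a) = (-1) ^ (m * a') * (-1) ^ m.
    by rewrite ea mulrDr mulr1 sgnD.
  by rewrite -mulrA sgn_sq mulr1.
by rewrite mulrC [(-1) ^ (m * a) * _]mulrC.
Qed.

Definition shift_module : dg_module B :=
  DgModule shift_mdD shift_mdd shift_mactDl shift_mactDr shift_mact1 shift_mactA
    shift_mdM.

End ShiftModule.

Lemma pairMz (U V : zmodType) (u : U) (v : V) (a : int) :
  (u, v) *~ a = (u *~ a, v *~ a).
Proof.
by rewrite [LHS]surjective_pairing (raddfMz fst) (raddfMz snd).
Qed.

(* Z(B): the condition on [dd] is vacuous for n <> -1 *)
Record closed_mor (B : dg_cat) (X Y : B) := ClosedMor {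
  cval :> dhom X Y 0;
  cvalP : forall n (e : 0 = n + 1), dd e cval = 0 }.

Section Cycle.
Variable B : dg_cat.

Lemma dd_id (X : B) n (e : 0 = n + 1) : dd e (did X) = 0.
Proof.
have e00 : 0 = 0 + 0 :> int by rewrite addr0.
have en : n = n + 0 by rewrite addr0.
have en' : n = 0 + n by rewrite add0r.
have := ddM e00 e e e en en' (did X) (did X).
by rewrite dcmp1l dcmp1l dcmp1r expr0z mulr1z -[LHS]addr0 => /addrI.
Qed.

Lemma closed_cmp_proof (X Y Z : B) (g : closed_mor Y Z) (f : closed_mor X Y)
    n (e : 0 = n + 1) : dd e (dcmp (esym (addr0 0)) g f) = 0.
Proof.
rewrite (ddM _ e e e (esym (addr0 n)) (esym (add0r n))) !cvalP.
by rewrite dcmp0l dcmp0r mul0rz addr0.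
Qed.

Definition closed_id (X : B) : closed_mor X X := ClosedMor (dd_id X).
Definition closed_cmp (X Y Z : B) (g : closed_mor Y Z) (f : closed_mor X Y) :
    closed_mor X Z := ClosedMor (closed_cmp_proof g f).

Definition closed_eq (X Y : B) (f g : closed_mor X Y) : Prop :=
  cval f = cval g.

Definition homologous (X Y : B) (f g : closed_mor X Y) : Prop :=
  exists h : dhom X Y 1, dd (esym (add0r 1)) h = cval f - cval g.

Lemma closed_eq_equiv (X Y : B) : Equivalence (@closed_eq X Y).
Proof. by split=> [f|f g|f g h]; rewrite /closed_eq // => ->. Qed.

Lemma closed_cmp_eq (X Y Z : B) (g g' : closed_mor Y Z) (f f' : closed_mor X Y) :
  closed_eq g g' -> closed_eq f f' ->
  closed_eq (closed_cmp g f) (closed_cmp g' f').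
Proof. by rewrite /closed_eq /= => -> ->. Qed.

Lemma closed_id_l (X Y : B) (f : closed_mor X Y) :
  closed_eq (closed_cmp (closed_id Y) f) f.
Proof. exact: dcmp1l. Qed.

Lemma closed_id_r (X Y : B) (f : closed_mor X Y) :
  closed_eq (closed_cmp f (closed_id X)) f.
Proof. exact: dcmp1r. Qed.

Lemma closed_assoc (X Y Z W : B) (h : closed_mor Z W) (g : closed_mor Y Z)
    (f : closed_mor X Y) :
  closed_eq (closed_cmp h (closed_cmp g f)) (closed_cmp (closed_cmp h g) f).
Proof. exact: dcmpA. Qed.

Definition cycle_cat : category :=
  @Category B (@closed_mor B) closed_eq closed_id closed_cmp
    closed_eq_equiv closed_cmp_eq closed_id_l closed_id_r closed_assoc.

Lemma closed_eq_homologous (X Y : B) (f g : closed_mor X Y) :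
  closed_eq f g -> homologous f g.
Proof. by move=> e; exists 0; rewrite e subrr dd0. Qed.

Lemma homologous_equiv (X Y : B) : Equivalence (@homologous X Y).
Proof.
split=> [f|f g [x ex]|f g h [x ex] [y ey]].
- exact: closed_eq_homologous.
- by exists (- x); rewrite ddN ex opprB.
- by exists (x + y); rewrite ddD ex ey addrA subrK.
Qed.

Lemma homologous_cmp (X Y Z : B) (g g' : closed_mor Y Z) (f f' : closed_mor X Y) :
  homologous g g' -> homologous f f' ->
  homologous (closed_cmp g f) (closed_cmp g' f').
Proof.
move=> [x ex] [y ey].
exists (dcmp (esym (addr0 1)) x f + dcmp (esym (add0r 1)) g' y).
have e0 : 0 = -1 + 1 :> int by [].
rewrite ddD (ddM _ _ (esym (add0r 1)) e0 (esym (addr0 0)) erefl).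
rewrite (ddM _ _ e0 (esym (add0r 1)) erefl (esym (addr0 0))).
rewrite ex ey !cvalP dcmp0r dcmp0l mul0rz expr0z mulr1z dcmpDl dcmpNl dcmpDr.
have tele (V : zmodType) (a b c : V) : a - b + 0 + (0 + (b - c)) = a - c.
  by rewrite addr0 add0r addrA subrK.
by rewrite dcmpNr tele.
Qed.

Definition homology_cat : category :=
  @Category B (@closed_mor B) homologous closed_id closed_cmp
    homologous_equiv homologous_cmp
    (fun X Y f => closed_eq_homologous (closed_id_l f))
    (fun X Y f => closed_eq_homologous (closed_id_r f))
    (fun X Y Z W h g f => closed_eq_homologous (closed_assoc h g f)).

End Cycle.

Arguments closed_mor {B}.

Section ConeModule.
Variables (B : dg_cat) (X Y : B) (f : closed_mor X Y).

Definition cone_mhom (Z : B) (k : int) : zmodType :=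
  (dhom Y Z k * dhom X Z (k + 1))%type.

Lemma cone_deg_act (a b k : int) : k = a + b -> k + 1 = a + (b + 1).
Proof. by move->; rewrite addrA. Qed.

Lemma cone_deg_d (a b : int) : a = b + 1 -> a + 1 = b + 1 + 1.
Proof. by move->. Qed.

Lemma cone_deg_f (a b : int) : a = b + 1 -> b + 1 = a + 0.
Proof. by move->; rewrite addr0. Qed.

Definition cone_md (Z : B) (a b : int) (e : a = b + 1) (x : cone_mhom Z a) :
    cone_mhom Z b :=
  (dd e x.1, dcmp (cone_deg_f e) x.1 f - dd (cone_deg_d e) x.2).

Definition cone_mact (V Z : B) (a b k : int) (e : k = a + b) (g : dhom V Z a)
    (x : cone_mhom V b) : cone_mhom Z k :=
  (dcmp e g x.1, dcmp (cone_deg_act e) g x.2 *~ (-1) ^ a).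

Lemma cone_mdD Z a b (e : a = b + 1) (x y : cone_mhom Z a) :
  cone_md e (x + y) = cone_md e x + cone_md e y.
Proof.
by rewrite /cone_md /= !ddD dcmpDl opprD addrACA.
Qed.

Lemma cone_mdd Z a b c (e : a = b + 1) (e' : b = c + 1) (x : cone_mhom Z a) :
  cone_md e' (cone_md e x) = 0.
Proof.
rewrite /cone_md /= ddD ddN !ddd oppr0 addr0; congr pair.
have e0 : 0 = -1 + 1 :> int by [].
have er : c + 1 = a + -1 by rewrite e e' addrK.
rewrite (ddM _ _ e e0 (cone_deg_f e') er) cvalP dcmp0r mul0rz addr0.
by rewrite subrr.
Qed.

Lemma cone_mactDl V Z a b k (e : k = a + b) (g g' : dhom V Z a)
    (x : cone_mhom V b) :
  cone_mact e (g + g') x = cone_mact e g x + cone_mact e g' x.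
Proof. by rewrite /cone_mact !dcmpDl mulrzDl. Qed.

Lemma cone_mactDr V Z a b k (e : k = a + b) (g : dhom V Z a)
    (x x' : cone_mhom V b) :
  cone_mact e g (x + x') = cone_mact e g x + cone_mact e g x'.
Proof. by rewrite /cone_mact !dcmpDr mulrzDl. Qed.

Lemma cone_mact1 V a (e : a = 0 + a) (x : cone_mhom V a) :
  cone_mact e (did V) x = x.
Proof. by case: x => x y; rewrite /cone_mact /= expr0z mulr1z !dcmp1l. Qed.

Lemma cone_mactA U V Z a b c ab bc abc
    (e1 : bc = b + c) (e2 : abc = a + bc) (e3 : ab = a + b) (e4 : abc = ab + c)
    (h : dhom V Z a) (g : dhom U V b) (x : cone_mhom U c) :
  cone_mact e2 h (cone_mact e1 g x) = cone_mact e4 (dcmp e3 h g) x.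
Proof.
rewrite /cone_mact /= dcmpZr -mulrzA.
have -> : (-1 : int) ^ ab = (-1) ^ b * (-1) ^ a by rewrite e3 sgnD mulrC.
by congr (_, _ *~ _); apply: dcmpA.
Qed.

Lemma cone_mdM V Z a b k a' b' k' (e : k = a + b)
    (ek : k = k' + 1) (ea : a = a' + 1) (eb : b = b' + 1)
    (el : k' = a' + b) (er : k' = a + b') (g : dhom V Z a) (x : cone_mhom V b) :
  cone_md ek (cone_mact e g x)
    = cone_mact el (dd ea g) x + cone_mact er g (cone_md eb x) *~ (-1) ^ a.
Proof.
have e0 : 0 = -1 + 1 :> int by [].
have sa : (-1 : int) ^ a = - (-1) ^ a' by rewrite ea sgnD expr1z mulrN1.
rewrite pairMz /cone_md /cone_mact /=; congr pair; first exact: ddM.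
rewrite ddZ (ddM _ _ ea (cone_deg_d eb) (cone_deg_act el) (cone_deg_act er)).
rewrite -[_ *~ _ *~ _ in RHS]mulrzA sgn_sq mulr1z dcmpDr dcmpNr.
rewrite mulrzDl -[_ *~ _ *~ _ in LHS]mulrzA sgn_sq mulr1z opprD sa mulrNz opprK.
rewrite addrCA; congr (_ + (_ - _)).
exact/esym/dcmpA.
Qed.

Definition cone_module : dg_module B :=
  DgModule cone_mdD cone_mdd cone_mactDl cone_mactDr cone_mact1 cone_mactA
    cone_mdM.

End ConeModule.

Section KernelModule.
Variables (B : dg_cat) (X Y : B) (i : closed_mor X Y).

Definition in_ker (Z : B) (k : int) : {pred dhom Y Z k} :=
  fun g => dcmp (esym (addr0 k)) g i == 0.

Lemma in_ker_zmod Z k : zmod_closed (@in_ker Z k).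
Proof.
split=> [|g g']; first by rewrite unfold_in dcmp0l.
by rewrite !unfold_in dcmpDl dcmpNl => /eqP-> /eqP->; rewrite subr0.
Qed.

HB.instance Definition _ Z k :=
  GRing.isZmodClosed.Build (dhom Y Z k) (@in_ker Z k) (@in_ker_zmod Z k).

Record kernel (Z : B) (k : int) :=
  Kernel { kval : dhom Y Z k; kvalP : kval \in @in_ker Z k }.

HB.instance Definition _ Z k := [isSub for @kval Z k].
HB.instance Definition _ Z k := [Choice of kernel Z k by <:].
HB.instance Definition _ Z k := [SubChoice_isSubZmodule of kernel Z k by <:].

Lemma in_ker_md Z m n (e : m = n + 1) (x : kernel Z m) :
  dd e (kval x) \in @in_ker Z n.
Proof.
have e0 : 0 = -1 + 1 :> int by [].
have er : n = m + -1 by rewrite e addrK.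
have := ddM (esym (addr0 m)) e e e0 (esym (addr0 n)) er (kval x) i.
have /eqP-> := kvalP x; rewrite cvalP dcmp0r mul0rz dd0 => h.
by rewrite unfold_in -[X in X == _]addr0 -h.
Qed.

Lemma in_ker_mact V Z m n k (e : k = m + n) (g : dhom V Z m) (x : kernel V n) :
  dcmp e g (kval x) \in @in_ker Z k.
Proof.
rewrite unfold_in -(dcmpA (esym (addr0 n)) e).
by have /eqP-> := kvalP x; rewrite dcmp0r.
Qed.

Definition ker_md Z m n (e : m = n + 1) (x : kernel Z m) : kernel Z n :=
  Kernel (in_ker_md e x).
Definition ker_mact V Z m n k (e : k = m + n) (g : dhom V Z m) (x : kernel V n) :
    kernel Z k := Kernel (in_ker_mact e g x).

Lemma ker_mdD Z m n (e : m = n + 1) (x y : kernel Z m) :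
  ker_md e (x + y) = ker_md e x + ker_md e y.
Proof. exact/val_inj/ddD. Qed.

Lemma ker_mdd Z m n k (e : m = n + 1) (e' : n = k + 1) (x : kernel Z m) :
  ker_md e' (ker_md e x) = 0.
Proof. exact/val_inj/ddd. Qed.

Lemma ker_mactDl V Z m n k (e : k = m + n) (g g' : dhom V Z m) (x : kernel V n) :
  ker_mact e (g + g') x = ker_mact e g x + ker_mact e g' x.
Proof. exact/val_inj/dcmpDl. Qed.

Lemma ker_mactDr V Z m n k (e : k = m + n) (g : dhom V Z m) (x x' : kernel V n) :
  ker_mact e g (x + x') = ker_mact e g x + ker_mact e g x'.
Proof. exact/val_inj/dcmpDr. Qed.

Lemma ker_mact1 V m (e : m = 0 + m) (x : kernel V m) : ker_mact e (did V) x = x.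
Proof. exact/val_inj/dcmp1l. Qed.

Lemma ker_mactA U V Z a b c ab bc abc
    (e1 : bc = b + c) (e2 : abc = a + bc) (e3 : ab = a + b) (e4 : abc = ab + c)
    (h : dhom V Z a) (g : dhom U V b) (x : kernel U c) :
  ker_mact e2 h (ker_mact e1 g x) = ker_mact e4 (dcmp e3 h g) x.
Proof. exact/val_inj/dcmpA. Qed.

Lemma ker_mdM V Z m n k m' n' k' (e : k = m + n)
    (ek : k = k' + 1) (em : m = m' + 1) (en : n = n' + 1)
    (el : k' = m' + n) (er : k' = m + n') (g : dhom V Z m) (x : kernel V n) :
  ker_md ek (ker_mact e g x)
    = ker_mact el (dd em g) x + ker_mact er g (ker_md en x) *~ (-1) ^ m.
Proof.
have vMz (y : kernel Z k') a : kval (y *~ a) = kval y *~ a.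
  exact: (raddfMz (\val : kernel Z k' -> _)).
by apply/val_inj; rewrite [RHS]raddfD /= vMz; apply: ddM.
Qed.

Definition kernel_module : dg_module B :=
  DgModule ker_mdD ker_mdd ker_mactDl ker_mactDr ker_mact1 ker_mactA ker_mdM.

End KernelModule.

Definition dg_zero_ob (B : dg_cat) (O : B) : Prop :=
  forall (X : B) (n : int),
    (forall f : dhom O X n, f = 0) /\ (forall f : dhom X O n, f = 0).

Definition pretriangulated (B : dg_cat) : Prop :=
  [/\ exists O : B, dg_zero_ob O,
      forall (X : B) (m : int), representable (shift_module X m) &
      forall (X Y : B) (f : closed_mor X Y), representable (cone_module f)].

Definition dg_weq (B : dg_cat) (X Y : B) (f : closed_mor X Y) : Prop :=
  @is_iso (homology_cat B) X Y f.

Definition dg_cof (B : dg_cat) (X Y : B) (i : closed_mor X Y) : Prop :=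
  (forall (Z : B) (k : int) (f : dhom X Z k),
     exists g : dhom Y Z k, dcmp (esym (addr0 k)) g i = f) /\
  representable (kernel_module i).

Definition cycle_cof_data (B : dg_cat) : cof_data :=
  @CofData (cycle_cat B) (@dg_cof B) (@dg_weq B).

(******************************************************************************)
(*   The homology category with its shift and triangles.  [sigma] chooses the *)
(* objects X[1] and their universal 0-cycles in B(X,-)[-1]; the latter are    *)
(* elements of B(X, X[1]) of degree 0 - -1.                                   *)
(******************************************************************************)

Definition shift_choice (B : dg_cat) : Type :=
  forall X : B, representation (shift_module X (-1)).

Section Homology.
Variables (B : dg_cat) (sigma : shift_choice B).

Let sh (X : B) : B := rep_ob (sigma X).
Let su (X : B) : dhom X (sh X) (0 - -1) := rep_u (sigma X).

Lemma shift_univ_cycle X n (e : 0 - -1 = n + 1) : dd e (su X) = 0.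
Proof.
have n0 : n = 0 by apply: (addIr 1); rewrite -e.
have e' : 0 = n - 1 + 1 by rewrite n0.
have en : n = (n - 1) - -1 by rewrite opprK subrK.
move: e; rewrite {n0}en => e.
have := rep_cycle (sigma X) e'.
rewrite /= /shift_md (eq_irrelevance (shift_deg_d _ e') e) => h.
by rewrite -[LHS](sgnK _ (-1)) h mul0rz.
Qed.

Lemma shift_univ_inj X Z k k' (e : k' = k + (0 - -1)) (f g : dhom (sh X) Z k) :
  dcmp e f (su X) = dcmp e g (su X) -> f = g.
Proof.
have E : k' = k - -1 by rewrite e sub0r.
move: e; rewrite E => e h.
have e0 : k = k + 0 by rewrite addr0.
rewrite -(rep_actK (r := sigma X) e0 f) -(rep_actK (r := sigma X) e0 g).
congr rep_inv; rewrite /= /shift_mact.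
by rewrite (eq_irrelevance (shift_deg_act _ e0) e) h.
Qed.

Lemma shift_univ_surj X Z k k' (e : k' = k + (0 - -1)) (x : dhom X Z k') :
  exists f : dhom (sh X) Z k, dcmp e f (su X) = x.
Proof.
have E : k' = k - -1 by rewrite e sub0r.
move: e x; rewrite E => e x.
have e0 : k = k + 0 by rewrite addr0.
exists (rep_inv (sigma X) ((x *~ (-1) ^ (-1 * k)) : shift_module X (-1) Z k)).
have := rep_invK (sigma X) e0 ((x *~ (-1) ^ (-1 * k)) : shift_module X (-1) Z k).
rewrite /= /shift_mact (eq_irrelevance (shift_deg_act _ e0) e) => h.
by rewrite -[LHS](sgnK _ (-1 * k)) h sgnK.
Qed.

(* f[1] is the unique morphism with f[1] . su X = su Y . f *)
Definition shift_val (X Y : B) (f : closed_mor X Y) : dhom (sh X) (sh Y) 0 :=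
  rep_inv (sigma X)
    (dcmp (esym (addr0 (0 - -1))) (su Y) f : shift_module X (-1) (sh Y) 0).

Lemma shift_valE X Y (f : closed_mor X Y) (e : 0 - -1 = 0 + (0 - -1)) e' :
  dcmp e (shift_val f) (su X) = dcmp e' (su Y) f.
Proof.
have := rep_invK (sigma X) (esym (addr0 0))
  (dcmp e' (su Y) f : shift_module X (-1) (sh Y) 0).
rewrite /= /shift_mact mulr0 expr0z mulr1z /shift_val.
by rewrite (eq_irrelevance (shift_deg_act _ _) e) (eq_irrelevance (esym _) e').
Qed.

Lemma shift_val_closed X Y (f : closed_mor X Y) n (e : 0 = n + 1) :
  dd e (shift_val f) = 0.
Proof.
have e1 : 0 - -1 = 0 + 1 :> int by [].
have el : 0 = n + (0 - -1) by [].
apply: (shift_univ_inj (e := el)); rewrite dcmp0l.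
have := ddM (esym (add0r (0 - -1))) e1 e e1 el erefl (shift_val f) (su X).
rewrite shift_univ_cycle dcmp0r mul0rz addr0 => <-.
rewrite (shift_valE _ _ (esym (addr0 _))).
have er : 0 = (0 - -1) + n by rewrite addrC.
rewrite (ddM _ _ e1 e erefl er) shift_univ_cycle cvalP.
by rewrite dcmp0l dcmp0r mul0rz addr0.
Qed.

Definition shift_mor (X Y : B) (f : closed_mor X Y) : closed_mor (sh X) (sh Y) :=
  ClosedMor (shift_val_closed f).

Lemma shift_mor_eqm (X Y : B) (f g : closed_mor X Y) :
  homologous f g -> homologous (shift_mor f) (shift_mor g).
Proof.
move=> [h eh]; rewrite /homologous /=.
have e1 : 0 - -1 = 0 + 1 :> int by [].
have e2 : 1 + 1 = 1 + (0 - -1) :> int by [].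
have e2' : 1 + 1 = (0 - -1) + 1 :> int by [].
have e2'' : 1 + 1 = (0 - -1) + 1 :> int by [].
have [w ew] := shift_univ_surj e2 (- dcmp e2' (su Y) h).
exists w; apply: (shift_univ_inj (e := esym (add0r (0 - -1)))).
have := ddM e2 e2' (esym (add0r 1)) e1 (esym (add0r _)) erefl w (su X).
rewrite shift_univ_cycle dcmp0r mul0rz addr0 => <-.
rewrite ew ddN (ddM _ _ e1 (esym (add0r 1)) erefl (esym (addr0 _))).
have fin (V : zmodType) (a : V) : - (0 + a *~ (-1) ^ (0 - -1 : int)) = a.
  by rewrite add0r (_ : (-1) ^ (0 - -1 : int) = -1 :> int) // mulrN1z opprK.
rewrite shift_univ_cycle dcmp0l fin eh dcmpDr dcmpNr dcmpDl dcmpNl.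
by rewrite !(shift_valE _ _ (esym (addr0 _))).
Qed.

Lemma shift_mor_id (X : B) : homologous (shift_mor (closed_id X)) (closed_id (sh X)).
Proof.
apply: closed_eq_homologous; rewrite /closed_eq /=.
apply: (shift_univ_inj (e := esym (add0r (0 - -1)))).
by rewrite (shift_valE _ _ (esym (addr0 _))) dcmp1l dcmp1r.
Qed.

Lemma shift_mor_cmp (X Y Z : B) (g : closed_mor Y Z) (f : closed_mor X Y) :
  homologous (shift_mor (closed_cmp g f))
    (closed_cmp (shift_mor g) (shift_mor f)).
Proof.
apply: closed_eq_homologous; rewrite /closed_eq /=.
apply: (shift_univ_inj (e := esym (add0r (0 - -1)))).
rewrite (shift_valE _ _ (esym (addr0 _))) /=.
rewrite -(dcmpA (esym (add0r _)) (esym (add0r _))).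
rewrite (shift_valE _ _ (esym (addr0 _))).
rewrite (dcmpA _ _ (esym (add0r _)) (esym (addr0 _))).
rewrite (shift_valE _ _ (esym (addr0 _))).
exact: dcmpA.
Qed.

Definition shift_functor : functor (homology_cat B) (homology_cat B) :=
  @Functor (homology_cat B) (homology_cat B) sh shift_mor
    shift_mor_eqm shift_mor_id shift_mor_cmp.

(* The triangle X -f-> Y -i-> Cf -pbar-> X[1] of a closed morphism f: [r] is a
   representation of the cone module of f, with object Cf and universal 0-cycle
   (i, u); p is the unique element of degree -1 of B(Cf, X) with
   p . (i, u) = (0, 1_X), and pbar = su X . p. *)
Definition is_cone_triangle (X Y : B) (f : closed_mor X Y)
    (r : representation (cone_module f))
    (i : closed_mor Y (rep_ob r)) (pbar : closed_mor (rep_ob r) (sh X)) : Prop :=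
  cval i = (rep_u r).1 /\
  exists p : dhom (rep_ob r) X (-1),
    mact (cone_module f) (esym (addr0 (-1))) p (rep_u r) = (0, did X) /\
    cval pbar = dcmp (esym (subrr 1)) (su X) p.

Definition homology_tri : tri_data :=
  @TriData (homology_cat B) shift_functor
    (fun X Y Z f g h =>
      exists (X' Y' : B) (f' : closed_mor X' Y')
             (r : representation (cone_module f'))
             (i : closed_mor Y' (rep_ob r)) (pbar : closed_mor (rep_ob r) (sh X')),
        is_cone_triangle i pbar /\
        @tri_iso _ shift_functor X' Y' (rep_ob r) X Y Z f' i pbar f g h).

End Homology.

Definition algebraic (T : tri_data) : Prop :=
  exists (B : dg_cat) (sigma : shift_choice B),
    pretriangulated B /\ tri_equivalent T (homology_tri sigma).

Definition topological (T : tri_data) : Prop :=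
  exists (C : cof_data) (S : suspension C),
    [/\ cofibration_category C, stable C & tri_equivalent T (Ho_tri S)].

(* Main.v *)
From HB Require Import structures.
From mathcomp Require Import all_boot all_order all_algebra.
From mathcomp Require Import boolp.
From Stdlib Require Import Setoid Morphisms.
Require Import Defs.

(* A closed morphism is a cofibration exactly when it is the inclusion of a
   degreewise split short exact sequence A -> E -> Q, so that E = A (+) Q with a
   differential twisted by a cycle phi : Q -> A of degree -1.  Every cycle phi
   occurs (as a mapping cone), pushouts along A -> D replace phi by its composite
   with A -> D, and the inclusion is a weak equivalence exactly when Q is
   contractible.  Every closed f : X -> Y factors through the extension of the
   cone Cf by X along the canonical Cf -> X of degree -1.
   Homotopic closed maps agree in the localization because X (+) Cone(id_X) is a
   cylinder, so Ho(Z(B)) and H(B) are isomorphic over the identity on objects.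
   Composing phi with the universal cycle A -> A[1] turns the extension
   A -> CA -> Sigma A into a homotopy equivalence Sigma A -> A[1], which
   characterizes the suspension functor; up to sign the same composite is the
   connecting morphism of A -> E -> Q, and this matches the two classes of
   triangles. *)

Set Implicit Arguments.
Unset Strict Implicit.
Unset Printing Implicit Defensive.
Import GRing.Theory.
Local Open Scope ring_scope.
Local Open Scope cat_scope.

(** * Categories and equivalences *)

(** Two difficulties shape the proof. The first is degree bookkeeping: every composite carries an
    equation between degrees, and the computations mix four or five factors with signs. Morphisms
    are therefore applied to families of elements of all degrees. The relations of a splitting or a
    cone become rewrite rules, and what remains is a linear identity in an abelian group, left to
    [abel]. Inverses and homotopies are given by formulas, and most of them arise in one way: the
    splittings [xs] and [xt] are not closed, with differentials [- xphi q] and [i xphi], and a term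
    built from a contraction, a homotopy or a cone element cancels this defect. The second
    difficulty is the sign: the two maps from CA u_A E to A[1] induced by [xphi], one through CA/A
    and one through E/A, are negatives of each other up to homotopy. So the comparison Sigma A ->
    A[1] carries a minus sign, the triangles carry none, and the two classes then match exactly. *)

#[global] Instance eqm_Equivalence (C : category) (X Y : C) : Equivalence (@eqm C X Y) :=
  eqm_equiv X Y.

#[global] Instance cmp_Proper (C : category) (X Y Z : C) :
  Proper (@eqm C Y Z ==> @eqm C X Y ==> @eqm C X Z) (@cmp C X Y Z).
Proof. by move=> g g' eg f f' ef; apply: cmp_eqm. Qed.

#[global] Instance fmap_Proper (C D : category) (F : functor C D) (X Y : C) :
  Proper (@eqm C X Y ==> @eqm D (F X) (F Y)) (@fmap C D F X Y).
Proof. by move=> f g; apply: fmap_eqm. Qed.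

Lemma eqm_refl (C : category) (X Y : C) (f : hom X Y) : f ~= f.
Proof. reflexivity. Qed.
Lemma eqm_sym (C : category) (X Y : C) (f g : hom X Y) : f ~= g -> g ~= f.
Proof. by symmetry. Qed.
Lemma eqm_trans (C : category) (X Y : C) (g f h : hom X Y) :
  f ~= g -> g ~= h -> f ~= h.
Proof. by move=> e1 e2; transitivity g. Qed.
#[global] Hint Resolve eqm_refl : core.

Section Categories.
Variable C : category.
Implicit Types X Y Z : C.

Lemma is_iso_id X : is_iso (idm X).
Proof. by exists (idm X); split; apply: cmp_id_l. Qed.

Lemma is_iso_eqm X Y (f g : hom X Y) : f ~= g -> is_iso f -> is_iso g.
Proof. by move=> e [h [h1 h2]]; exists h; split; rewrite -e. Qed.

Lemma is_iso_inv X Y (f : hom X Y) (g : hom Y X) : are_inverse f g -> is_iso g.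
Proof. by move=> [h1 h2]; exists f; split. Qed.

Lemma is_iso_cmp X Y Z (g : hom Y Z) (f : hom X Y) :
  is_iso f -> is_iso g -> is_iso (g \o f).
Proof.
move=> [f' [f1 f2]] [g' [g1 g2]]; exists (f' \o g'); split.
  by rewrite cmp_assoc -(cmp_assoc f') g1 cmp_id_r.
by rewrite cmp_assoc -(cmp_assoc g) f2 cmp_id_r.
Qed.

Lemma is_iso_cancel_l X Y Z (g : hom Y Z) (f : hom X Y) :
  is_iso g -> is_iso (g \o f) -> is_iso f.
Proof.
move=> [g' [g1 g2]] hgf.
apply: (is_iso_eqm _ (is_iso_cmp hgf (is_iso_inv (conj g1 g2)))).
by rewrite cmp_assoc g1 cmp_id_l.
Qed.

Lemma is_iso_cancel_r X Y Z (g : hom Y Z) (f : hom X Y) :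
  is_iso f -> is_iso (g \o f) -> is_iso g.
Proof.
move=> [f' [f1 f2]] hgf.
apply: (is_iso_eqm _ (is_iso_cmp (is_iso_inv (conj f1 f2)) hgf)).
by rewrite -cmp_assoc f2 cmp_id_r.
Qed.

Lemma iso_monic X Y Z (g : hom Y Z) (f f' : hom X Y) :
  is_iso g -> g \o f ~= g \o f' -> f ~= f'.
Proof.
move=> [g' [e _]] h.
by rewrite -(cmp_id_l f) -(cmp_id_l f') -e -!cmp_assoc h.
Qed.

Lemma iso_epic X Y Z (g g' : hom Y Z) (f : hom X Y) :
  is_iso f -> g \o f ~= g' \o f -> g ~= g'.
Proof.
move=> [f' [_ e]] h.
by rewrite -(cmp_id_r g) -(cmp_id_r g') -e !cmp_assoc h.
Qed.

Lemma pushout_epic (A D E P : C) (i : hom A E) (f : hom A D) (k : hom E P) (j : hom D P)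
    (Q : C) (u v : hom P Q) : is_pushout i f k j ->
  u \o k ~= v \o k -> u \o j ~= v \o j -> u ~= v.
Proof.
move=> [e univ] ek ej.
have e' : (v \o k) \o i ~= (v \o j) \o f by rewrite -!cmp_assoc e.
have [w [wk wj] h] := univ Q _ _ e'.
rewrite (h u) // (h v) //; reflexivity.
Qed.

Lemma pushout_sym (A D E P : C) (i : hom A E) (f : hom A D) (k : hom E P) (j : hom D P) :
  is_pushout i f k j -> is_pushout f i j k.
Proof.
move=> [e univ]; split=> [|Q k' j' e']; first by symmetry.
have [u [uk uj] h] := univ Q j' k' (Equivalence_Symmetric _ _ e').
by exists u => // u' ? ?; apply: h.
Qed.

Lemma pushout_unique (A D E P P' : C) (i : hom A E) (f : hom A D)
    (k : hom E P) (j : hom D P) (k' : hom E P') (j' : hom D P') :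
  is_pushout i f k j -> is_pushout i f k' j' ->
  exists (u : hom P P') (v : hom P' P), are_inverse u v /\
    [/\ u \o k ~= k', u \o j ~= j', v \o k' ~= k & v \o j' ~= j].
Proof.
move=> po po'.
have [u [uk uj] _] := po.2 _ k' j' po'.1.
have [v [vk vj] _] := po'.2 _ k j po.1.
exists u, v; split=> //; split.
  by apply: (pushout_epic po); rewrite -cmp_assoc ?uk ?uj ?vk ?vj cmp_id_l.
by apply: (pushout_epic po'); rewrite -cmp_assoc ?vk ?vj ?uk ?uj cmp_id_l.
Qed.

End Categories.

(** [is_equivalence] asks for an actual functor, so choice supplies preimages of objects with
    isomorphisms [e], and a lift of each conjugate [e' f e]. Faithfulness makes the lifts
    functorial. *)
Lemma ff_equivalence (C D : category) (F : functor C D) :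
  (forall (X Y : C) (f g : hom X Y), fmap F f ~= fmap F g -> f ~= g) ->
  (forall (X Y : C) (h : hom (F X) (F Y)), exists f : hom X Y, fmap F f ~= h) ->
  (forall Y : D, exists (X : C) (h : hom (F X) Y), is_iso h) ->
  is_equivalence F.
Proof.
move=> faithful full es.
have /all_tag [G0 eG] : forall Y : D,
    {X : C & {h : hom (F X) Y & {k : hom Y (F X) | are_inverse h k}}}.
  by move=> Y; case: (cid (es Y)) => X /cid [h /cid [k hk]]; exists X, h, k.
have {eG} /all_tag [e /all_sig [e' ee']] := eG.
have lift X Y (h : hom (F X) (F Y)) : {f : hom X Y | fmap F f ~= h} by exact: cid.
pose Gm X Y (f : hom X Y) : hom (G0 X) (G0 Y) := sval (lift _ _ (e' Y \o (f \o e X))).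
have GmE X Y (f : hom X Y) : fmap F (Gm X Y f) ~= e' Y \o (f \o e X).
  by rewrite /Gm; case: (lift _ _ _).
have G1 X Y (f g : hom X Y) : f ~= g -> Gm X Y f ~= Gm X Y g.
  by move=> fg; apply: faithful; rewrite !GmE fg.
have G2 X : Gm X X (idm X) ~= idm (G0 X).
  by apply: faithful; rewrite GmE cmp_id_l fmap_id (ee' X).1.
have G3 X Y Z (g : hom Y Z) (f : hom X Y) : Gm X Z (g \o f) ~= Gm Y Z g \o Gm X Y f.
  apply: faithful; rewrite fmap_cmp !GmE !cmp_assoc -(cmp_assoc _ (e Y)).
  by rewrite (ee' Y).2 cmp_id_r -!cmp_assoc.
pose G := @Functor D C G0 Gm G1 G2 G3.
exists G; split; last first.
  constructor; exists e.
    by move=> Y; exists (e' Y); apply: ee'.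
  by move=> X Y f /=; rewrite GmE (cmp_assoc (e Y)) (ee' Y).2 cmp_id_l.
constructor; pose al X := sval (lift (G (F X)) X (e (F X))).
have alE X : fmap F (al X) ~= e (F X) by rewrite /al; case: (lift _ _ _).
exists al.
  move=> X; pose be := sval (lift X (G (F X)) (e' (F X))).
  have beE : fmap F be ~= e' (F X) by rewrite /be; case: (lift _ _ _).
  exists be; split; apply: faithful; rewrite fmap_cmp alE beE fmap_id.
    exact: (ee' _).1.
  exact: (ee' _).2.
move=> X Y f /=; apply: faithful; rewrite !fmap_cmp !alE GmE.
by rewrite (cmp_assoc (e (F Y))) (ee' (F Y)).2 cmp_id_l.
Qed.

(** * Identities in abelian groups *)

Inductive zexpr := ZVar of nat | ZZero | ZAdd of zexpr & zexpr | ZOpp of zexpr.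

Fixpoint zeval (V : zmodType) (env : seq V) (t : zexpr) : V :=
  match t with
  | ZVar n => nth 0 env n
  | ZZero => 0
  | ZAdd a b => zeval env a + zeval env b
  | ZOpp a => - zeval env a
  end.

Fixpoint zcoef (t : zexpr) (n : nat) : int :=
  match t with
  | ZVar m => if m == n then 1 else 0
  | ZZero => 0
  | ZAdd a b => zcoef a n + zcoef b n
  | ZOpp a => - zcoef a n
  end.

Lemma zeval_coef (V : zmodType) (env : seq V) t :
  zeval env t = \sum_(i < size env) nth 0 env i *~ zcoef t i.
Proof.
elim: t => /= [n||a -> b ->|a ->].
- case: (ltnP n (size env)) => hn; last first.
    rewrite nth_default // big1 // => i _.
    by rewrite gtn_eqF ?mulr0z //; apply: leq_trans (ltn_ord i) hn.
  rewrite (bigD1 (Ordinal hn)) //= eqxx mulr1z big1 ?addr0 // => i ni.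
  by rewrite eq_sym (negbTE (ni : (i : nat) != n)) mulr0z.
- by rewrite big1 // => i _; rewrite mulr0z.
- by rewrite -big_split /=; apply: eq_bigr => i _; rewrite mulrzDr.
- by rewrite -sumrN; apply: eq_bigr => i _; rewrite mulrNz.
Qed.

(** The coefficients of reified terms are concrete integers, so the hypothesis is closed by
    computation; this is what [abel] applies. *)
Lemma zeval_eq (V : zmodType) (env : seq V) t1 t2 :
  all (fun n => zcoef t1 n == zcoef t2 n) (iota 0 (size env)) ->
  zeval env t1 = zeval env t2.
Proof.
move=> /allP h; rewrite !zeval_coef; apply: eq_bigr => i _.
by rewrite (eqP (h i _)) // mem_iota add0n ltn_ord.
Qed.

(* [unify] is needed because equal atoms can carry degrees that agree only up to
   computation. *)
Ltac zmem a l :=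
  lazymatch l with
  | [::] => constr:(false)
  | ?b :: ?l' =>
    match constr:(Set) with
    | _ => let _ := match constr:(Set) with _ => first [constr_eq a b | unify a b] end in constr:(true)
    | _ => zmem a l'
    end
  end.
Ltac zatoms l t :=
  lazymatch t with
  | GRing.add ?a ?b => let l1 := zatoms l a in zatoms l1 b
  | GRing.opp ?a => zatoms l a
  | GRing.zero => l
  | _ => let m := zmem t l in
         lazymatch m with true => l | false => constr:(t :: l) end
  end.
Ltac zindex a l :=
  lazymatch l with
  | ?b :: ?l' =>
    match constr:(Set) with
    | _ => let _ := match constr:(Set) with _ => first [constr_eq a b | unify a b] end in constr:(0%N)
    | _ => let n := zindex a l' in constr:(n.+1)
    end
  end.
Ltac zreify l t :=
  lazymatch t with
  | GRing.add ?a ?b =>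
    let a' := zreify l a in let b' := zreify l b in constr:(ZAdd a' b')
  | GRing.opp ?a => let a' := zreify l a in constr:(ZOpp a')
  | GRing.zero => constr:(ZZero)
  | _ => let n := zindex t l in constr:(ZVar n)
  end.
Ltac abel :=
  lazymatch goal with
  | |- @eq ?T ?a ?b =>
    let l0 := constr:(@nil T) in
    let l1 := zatoms l0 a in let l := zatoms l1 b in
    let a' := zreify l a in let b' := zreify l b in
    refine (@zeval_eq _ l a' b' _); reflexivity
  end.

(** * Graded elements of a dg category *)

Section GradedElements.
Variable B : dg_cat.

(* Families of elements of all degrees: identities between composites of
   morphisms are checked on them, so that no degrees have to be tracked. *)
Definition gel (W X : B) : Type := forall k : int, dhom W X k.

HB.instance Definition _ W X := gen_eqMixin (gel W X).
HB.instance Definition _ W X := gen_choiceMixin (gel W X).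

Section Zmodule.
Variables W X : B.
Implicit Types x y z : gel W X.

Definition gel_add x y : gel W X := fun k => x k + y k.
Definition gel_opp x : gel W X := fun k => - x k.
Definition gel_zero : gel W X := fun k => 0.

Lemma gelP x y : (forall k, x k = y k) -> x = y.
Proof. exact: functional_extensionality_dep. Qed.

Lemma gel_addA : associative gel_add.
Proof. by move=> x y z; apply: gelP => k; apply: addrA. Qed.
Lemma gel_addC : commutative gel_add.
Proof. by move=> x y; apply: gelP => k; apply: addrC. Qed.
Lemma gel_add0 : left_id gel_zero gel_add.
Proof. by move=> x; apply: gelP => k; apply: add0r. Qed.
Lemma gel_addN : left_inverse gel_zero gel_opp gel_add.
Proof. by move=> x; apply: gelP => k; apply: addNr. Qed.

HB.instance Definition _ :=
  GRing.isZmodule.Build (gel W X) gel_addA gel_addC gel_add0 gel_addN.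

End Zmodule.

Definition act (W X Y : B) (m : int) (f : dhom X Y m) (x : gel W X) : gel W Y :=
  fun k => dcmp (esym (subrKC m k)) f (x (k - m)).

Definition gD (W X : B) (x : gel W X) : gel W X := fun k => dd erefl (x (k + 1)).

Lemma actE (W X Y : B) m k j (e : k = m + j) (f : dhom X Y m) (x : gel W X) :
  act f x k = dcmp e f (x j).
Proof.
rewrite /act; have ej : j = k - m by rewrite e addrC addKr.
move: e; rewrite {j}ej => e; congr dcmp; exact: eq_irrelevance.
Qed.

Lemma gDE (W X : B) k j (e : j = k + 1) (x : gel W X) : gD x k = dd e (x j).
Proof. by move: e => e; subst j. Qed.

Definition gel_of (X Y : B) m (f : dhom X Y m) : gel X Y :=
  fun k => match m =P k with
           | ReflectT e => eq_rect m (dhom X Y) f k e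
           | ReflectF _ => 0
           end.

Lemma gel_ofE X Y m (f : dhom X Y m) : gel_of f m = f.
Proof.
rewrite /gel_of; case: eqP => // e.
by rewrite (eq_irrelevance e erefl).
Qed.

(** Yoneda: it suffices to test on the identity of X, as a family concentrated in degree 0. *)
Lemma act_inj X Y m (f g : dhom X Y m) :
  (forall W (x : gel W X), act f x = act g x) -> f = g.
Proof.
move=> h; have := congr1 (@^~ m) (h X (gel_of (did X))).
by rewrite !(actE (esym (addr0 m))) gel_ofE !dcmp1r.
Qed.

Section Act.
Variables W X Y Z : B.
Implicit Types (x y : gel W X).

Lemma actD m (f : dhom X Y m) x y : act f (x + y) = act f x + act f y.
Proof. by apply: gelP => k; apply: dcmpDr. Qed.
Lemma actN m (f : dhom X Y m) x : act f (- x) = - act f x.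
Proof. by apply: gelP => k; apply: dcmpNr. Qed.
Lemma act0 m (f : dhom X Y m) : act f (0 : gel W X) = 0.
Proof. by apply: gelP => k; apply: dcmp0r. Qed.
Lemma addact m (f g : dhom X Y m) x : act (f + g) x = act f x + act g x.
Proof. by apply: gelP => k; apply: dcmpDl. Qed.
Lemma oppact m (f : dhom X Y m) x : act (- f) x = - act f x.
Proof. by apply: gelP => k; apply: dcmpNl. Qed.
Lemma zeroact m x : act (0 : dhom X Y m) x = 0.
Proof. by apply: gelP => k; apply: dcmp0l. Qed.
Lemma idact x : act (did X) x = x.
Proof. by apply: gelP => k; rewrite (actE (esym (add0r k))) dcmp1l. Qed.
Lemma cmpact m n k (e : k = m + n) (g : dhom Y Z m) (f : dhom X Y n) x :
  act (dcmp e g f) x = act g (act f x).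
Proof.
apply: gelP => j; rewrite (actE (esym (subrKC m j))) (actE (esym (subrKC n _))).
have ej : j = k + (j - m - n) by rewrite e addrACA subrKC subrr addr0.
by rewrite (actE ej) -(dcmpA (esym (subrKC n _)) (esym (subrKC m j))).
Qed.
Lemma gDD x y : gD (x + y) = gD x + gD y.
Proof. by apply: gelP => k; apply: ddD. Qed.
Lemma gDN x : gD (- x) = - gD x.
Proof. by apply: gelP => k; apply: ddN. Qed.
Lemma gD0 : gD (0 : gel W X) = 0.
Proof. by apply: gelP => k; apply: dd0. Qed.
Lemma gDK x : gD (gD x) = 0.
Proof. by apply: gelP => k; apply: ddd. Qed.

Lemma gD_act m n (e : m = n + 1) (f : dhom X Y m) x :
  gD (act f x) = act (dd e f) x + act f (gD x) *~ (-1) ^ m.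
Proof.
apply: gelP => k.
have pw (y : gel W Y) (a : int) : (y *~ a) k = y k *~ a.
  have nat b : (y *+ b) k = y k *+ b by elim: b => // b IH; rewrite !mulrS -IH.
  by case: a => b; rewrite ?NegzE ?mulrNz -!pmulrn -nat.
have el : k = n + (k + 1 - m) by rewrite e opprD addrACA addrN addr0 subrKC.
have er : k = m + (k - m) by rewrite subrKC.
have en : k + 1 - m = (k - m) + 1 by rewrite addrAC.
have := ddM (esym (subrKC m (k + 1))) erefl e en el er f (x _).
rewrite -/(act f x (k + 1)) -/(gD (act f x) k) => ->.
transitivity (act (dd e f) x k + (act f (gD x) *~ (-1) ^ m) k) => //.
by rewrite pw (actE el) (actE er) (gDE en).
Qed.

End Act.

(** The Leibniz rule [gD_act] determines the differential. Closedness and homotopies, whose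
    definitions mention [dd], are thereby reduced to identities on elements. *)
Lemma dd_eq X Y m n (e : m = n + 1) (f : dhom X Y m) (g : dhom X Y n) :
  (forall W (x : gel W X), gD (act f x) = act g x + act f (gD x) *~ (-1) ^ m) ->
  dd e f = g.
Proof.
move=> h; apply: act_inj => W x; have := h W x.
by rewrite (gD_act e) => /addIr.
Qed.

End GradedElements.

(* keeps the unification of atoms in [abel] from unfolding *)
#[global] Opaque act gD.

(** * Degreewise split extensions *)

Notation "f $ x" := (act f x) (at level 30, right associativity) : ring_scope.
(* the equation between concrete degrees is solved by computation *)
Notation "g ** f" := (dcmp ltac:(exact: erefl) g f)
  (at level 40, left associativity, only parsing) : ring_scope.

Lemma deg0_eq : 0 = -1 + 1 :> int. Proof. by []. Qed.

Section Closed.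
Variable B : dg_cat.

Lemma gD_deg0 (W X Y : B) n (e : 0 = n + 1) (f : dhom X Y 0) (x : gel W X) :
  gD (f $ x) = dd e f $ x + f $ gD x.
Proof. by rewrite (gD_act e) expr0z mulr1z. Qed.

Lemma gD_deg1 (W X Y : B) n (e : 1 = n + 1) (f : dhom X Y 1) (x : gel W X) :
  gD (f $ x) = dd e f $ x - f $ gD x.
Proof. by rewrite (gD_act e) expr1z mulrN1z. Qed.

Lemma gD_degN1 (W X Y : B) n (e : -1 = n + 1) (f : dhom X Y (-1)) (x : gel W X) :
  gD (f $ x) = dd e f $ x - f $ gD x.
Proof. by rewrite (gD_act e) (_ : (-1 : int) ^ (-1) = -1) // mulrN1z. Qed.

Lemma gD_closed (W X Y : B) (f : closed_mor X Y) (x : gel W X) :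
  gD (f $ x) = f $ gD x.
Proof.
have e0 : 0 = -1 + 1 :> int by [].
by rewrite (gD_deg0 e0) cvalP zeroact add0r.
Qed.

Lemma closed_intro (X Y : B) (f : dhom X Y 0) :
  (forall W (x : gel W X), gD (f $ x) = f $ gD x) ->
  forall n (e : 0 = n + 1), dd e f = 0.
Proof.
move=> h n e; apply: dd_eq => W x.
by rewrite h zeroact expr0z mulr1z add0r.
Qed.

Lemma closed_eqP (X Y : B) (f g : closed_mor X Y) :
  closed_eq f g <-> forall W (x : gel W X), f $ x = g $ x.
Proof. by split=> [-> //|h]; apply: act_inj. Qed.

Lemma homologousP (X Y : B) (f g : closed_mor X Y) :
  homologous f g <-> exists h : dhom X Y 1,
    forall W (x : gel W X), gD (h $ x) + h $ gD x = f $ x - g $ x.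
Proof.
split=> [[h e]|[h e]]; exists h.
  by move=> W x; rewrite (gD_deg1 (esym (add0r 1))) e addact oppact subrK.
apply: dd_eq => W x; rewrite addact oppact expr1z mulrN1z.
by rewrite -e addrK.
Qed.

Lemma id_act (W X : B) (x : gel W X) : closed_id X $ x = x.
Proof. exact: idact. Qed.

Lemma closed_cmp_act (W X Y Z : B) (g : closed_mor Y Z) (f : closed_mor X Y)
  (x : gel W X) : closed_cmp g f $ x = g $ f $ x.
Proof. exact: cmpact. Qed.

End Closed.

Definition actR := (closed_cmp_act, id_act, cmpact, addact, oppact, zeroact, idact,
  actD, actN, act0, gDD, gDN, gD0, gDK, gD_closed).

Section Extensions.
Variable B : dg_cat.

(* A degreewise split short exact sequence A -> E -> Q; [xphi] is the
   off-diagonal entry of the differential of E = A (+) Q. *)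
Record split_ext (A E Q : B) (i : closed_mor A E) (q : closed_mor E Q) := SplitExt {
  xs : dhom E A 0;
  xt : dhom Q E 0;
  xphi : dhom Q A (-1);
  x_si : forall W (x : gel W A), xs $ i $ x = x;
  x_qt : forall W (x : gel W Q), q $ xt $ x = x;
  x_is : forall W (x : gel W E), i $ xs $ x = x - xt $ q $ x;
  x_Dt : forall W (x : gel W Q), gD (xt $ x) = i $ xphi $ x + xt $ gD x }.

Section ExtTheory.
Variables (A E Q : B) (i : closed_mor A E) (q : closed_mor E Q) (X : split_ext i q).

Lemma x_qi W (x : gel W A) : q $ i $ x = 0.
Proof.
rewrite -[LHS](x_qt X); have := x_is X (i $ x).
by rewrite (x_si X) => /eqP; rewrite eq_sym subr_eq addrC -subr_eq subrr => /eqP<-;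
   rewrite act0.
Qed.

Lemma x_st W (x : gel W Q) : xs X $ xt X $ x = 0.
Proof.
by rewrite -[LHS](x_si X) (x_is X) (x_qt X) subrr act0.
Qed.

(** Differentiate [x_is] and apply [xs]. *)
Lemma x_Ds W (x : gel W E) :
  gD (xs X $ x) = - (xphi X $ q $ x) + xs X $ gD x.
Proof.
have := congr1 (fun y => xs X $ gD y) (x_is X x); rewrite /= gDD gDN (x_Dt X).
rewrite gD_closed (x_si X) actD actN => ->.
rewrite actD (x_si X) gD_closed x_st; abel.
Qed.

(** This is D^2 = 0 at [xt X $ x], read through [xs]. *)
Lemma x_Dphi W (x : gel W Q) : gD (xphi X $ x) = - (xphi X $ gD x).
Proof.
have := congr1 (fun y => xs X $ gD y) (x_Dt X x).
rewrite gDK gDD gD_closed (x_Dt X) gDK !actR !(x_si X) addr0 => /esym/eqP.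
by rewrite addr_eq0 => /eqP.
Qed.

Definition extR := (x_si X, x_qi, x_st, x_qt X, x_is X, x_Dt X, x_Ds, x_Dphi).

End ExtTheory.

(** Surjectivity of restriction along [i], applied to the identity of A, gives a retraction [s]. The
    universal cycle of the kernel module is [q], and 1 - i s, being killed by [i], factors uniquely
    as t q. Conversely, a [g] with g i = 0 equals (g t) q, so [q] represents the kernel. *)
Lemma cof_ext (A E : B) (i : closed_mor A E) :
  dg_cof i <-> exists (Q : B) (q : closed_mor E Q), inhabited (split_ext i q).
Proof.
split=> [[surj [r]]|[Q [q [X]]]].
- have [s es] := surj A 0 (did A).
  have si W (x : gel W A) : s $ i $ x = x.
    by rewrite -(cmpact (esym (addr0 _))) es idact.
  set Q := rep_ob r; pose q0 : dhom E Q 0 := kval (rep_u r).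
  have qi W (x : gel W A) : q0 $ i $ x = 0.
    by rewrite -(cmpact (esym (addr0 _))) (eqP (kvalP (rep_u r))) zeroact.
  have q0P n (e : 0 = n + 1) : dd e q0 = 0.
    by have := congr1 (@kval _ _ _ _ _ _) (rep_cycle r e).
  pose q := ClosedMor q0P.
  pose w : dhom E E 0 := did E - i ** s.
  have wP : w \in @in_ker B A E i E 0.
    apply/eqP/act_inj => W x.
    by rewrite /w !actR si subrr.
  pose t : dhom Q E 0 := rep_inv r (Kernel wP).
  have tq W (x : gel W E) : t $ q $ x = x - i $ s $ x.
    have := congr1 (@kval _ _ _ _ _ _) (rep_invK r (esym (addr0 0)) (Kernel wP)).
    rewrite /= => /(congr1 (fun f => f $ x)); rewrite cmpact => ->.
    by rewrite /w !actR.
  have qt W (x : gel W Q) : q $ t $ x = x.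
    have eq (g h : dhom Q Q 0) :
        dcmp (esym (addr0 0)) g q = dcmp (esym (addr0 0)) h q -> g = h.
      move=> e; rewrite -(rep_actK (r := r) (esym (addr0 0)) g).
      rewrite -(rep_actK (r := r) (esym (addr0 0)) h); congr rep_inv.
      exact/val_inj.
    suff e : dcmp (esym (addr0 0)) q t = did Q.
      by rewrite -(cmpact (esym (addr0 0))) e idact.
    by apply: eq; apply: act_inj => W' y; rewrite !actR tq !actR qi subr0.
  (* Since q t = 1 and [q] is closed, [q] kills dt. Hence dt = i (s dt), and s dt is the
     off-diagonal entry. *)
  pose t' := dd deg0_eq t.
  exists Q, q; constructor.
  apply: (@SplitExt _ _ _ i q s t (s ** t')) => //.
    by move=> W x; rewrite tq; abel.
  move=> W x; rewrite (gD_deg0 deg0_eq) -/t' cmpact; congr (_ + _).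
  have -> : i $ s $ t' $ x = t' $ x - t $ q $ t' $ x by rewrite tq; abel.
  have : gD (q $ t $ x) = gD x by rewrite qt.
  rewrite gD_closed (gD_deg0 deg0_eq) -/t' actD qt.
  by move/eqP; rewrite eq_sym -subr_eq subrr => /eqP <-; rewrite act0 subr0.
- split.
    move=> Z k f; exists (dcmp (esym (addr0 k)) f (xs X)).
    by apply: act_inj => W x; rewrite !actR (x_si X).
  have qP : cval q \in @in_ker B A E i Q 0.
    by apply/eqP/act_inj => W x; rewrite cmpact (x_qi X) zeroact.
  constructor.
  apply: (@Representation _ _ Q (Kernel qP : kernel_module i Q 0) _
    (fun Z k x => dcmp (esym (addr0 k)) (kval x) (xt X))).
  + by move=> n e; apply/val_inj/cvalP.
  + move=> Z k e x; apply/val_inj/act_inj => W y /=; rewrite !actR.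
    have kx V (z : gel V A) : kval x $ i $ z = 0.
      by rewrite -(cmpact (esym (addr0 _))) (eqP (kvalP x)) zeroact.
    by rewrite -[y in RHS](subrK (xt X $ q $ y)) -(x_is X) actD kx add0r.
  + by move=> Z k e f; apply/act_inj => W y /=; rewrite !actR (x_qt X).
Qed.

End Extensions.

(** * Shifts, cones and extensions with prescribed class *)

Section Constructions.
Variable B : dg_cat.

Lemma gel_of_id_act (W X : B) k (x : gel W X) : k = 0 -> gel_of (did X) k $ x = x.
Proof. by move=> ->; rewrite gel_ofE idact. Qed.

Lemma shift_unit (X : B) m (r : representation (shift_module X m)) :
  let u : dhom X (rep_ob r) (0 - m) := rep_u r in
  [/\ forall n (e : 0 - m = n + 1), dd e u = 0 &
      exists v : dhom (rep_ob r) X m,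
        (forall W (x : gel W X), v $ u $ x = x) /\
        (forall W (x : gel W (rep_ob r)), u $ v $ x = x)].
Proof.
move=> u; split.
  move=> n e; have n0 : 0 = (n + m) + 1 by rewrite addrAC -e sub0r addNr.
  have en : n = (n + m) - m by rewrite addrK.
  move: (n + m) n0 en => k n0 en; subst n.
  have := rep_cycle r n0; rewrite /= /shift_md (eq_irrelevance (shift_deg_d _ n0) e) => h.
  by rewrite -[LHS](sgnK _ m) h mul0rz.
have uinj k k' (e : k' = k + (0 - m)) Z (f g : dhom (rep_ob r) Z k) :
    dcmp e f u = dcmp e g u -> f = g.
  have E : k' = k - m by rewrite e sub0r.
  move: e; rewrite E => e h.
  have e0 : k = k + 0 by rewrite addr0.
  rewrite -(rep_actK (r := r) e0 f) -(rep_actK (r := r) e0 g).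
  congr rep_inv; rewrite /= /shift_mact.
  by rewrite (eq_irrelevance (shift_deg_act _ e0) e) h.
(* The inverse of [u] corresponds to the identity of X, which has to sit in degree m - m. This
   degree is not convertible to 0, hence [gel_of]. The sign cancels the one in [shift_mact]. *)
pose v : dhom (rep_ob r) X m :=
  rep_inv r ((gel_of (did X) (m - m) *~ (-1) ^ (m * m)) : shift_module X m X m).
have vu W (x : gel W X) : v $ u $ x = x.
  have e0 : m = m + 0 by rewrite addr0.
  have := rep_invK r e0
    ((gel_of (did X) (m - m) *~ (-1) ^ (m * m)) : shift_module X m X m).
  rewrite /= /shift_mact => h.
  have {}h : dcmp (shift_deg_act m e0) v u = gel_of (did X) (m - m).
    by rewrite -[LHS](sgnK _ (m * m)) h sgnK.
  by rewrite -(cmpact (shift_deg_act m e0)) h gel_of_id_act ?subrr.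
exists v; split=> // W x.
have e1 : 0 = 0 - m + m :> int by rewrite subrK.
have -> : u $ v $ x = dcmp e1 u v $ x by rewrite cmpact.
rewrite (_ : dcmp e1 u v = did _) ?idact //.
apply: (uinj _ _ (esym (add0r _))); apply: act_inj => W' y.
by rewrite !cmpact vu idact.
Qed.

(** C is Y (+) X shifted by one: [i], [c_u] are the inclusions and [c_rho], [p] the projections. The
    minus sign in [c_pu] is forced by the sign with which the degree -1 element [p] acts on the
    second component of the cone module. *)
Record cone_data (X Y C : B) (f : closed_mor X Y) (i : closed_mor Y C)
    (p : dhom C X (-1)) := ConeData {
  c_u : dhom X C 1;
  c_rho : dhom C Y 0;
  c_ri : forall W (x : gel W Y), c_rho $ i $ x = x;
  c_ru : forall W (x : gel W X), c_rho $ c_u $ x = 0;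
  c_pi : forall W (x : gel W Y), p $ i $ x = 0;
  c_pu : forall W (x : gel W X), p $ c_u $ x = - x;
  c_ir : forall W (x : gel W C), i $ c_rho $ x = x + c_u $ p $ x;
  c_Du : forall W (x : gel W X), gD (c_u $ x) = i $ f $ x - c_u $ gD x;
  c_Drho : forall W (x : gel W C), gD (c_rho $ x) = f $ p $ x + c_rho $ gD x;
  c_Dp : forall W (x : gel W C), gD (p $ x) = - (p $ gD x) }.

Definition coneR X Y C f i p (K : @cone_data X Y C f i p) :=
  (c_ri K, c_ru K, c_pi K, c_pu K, c_ir K, c_Du K, c_Drho K, c_Dp K).

Section ConeRep.
Variables (X Y : B) (f : closed_mor X Y) (r : representation (cone_module f)).

Lemma cone_rep_inj Z k (g h : dhom (rep_ob r) Z k) :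
  (forall W (x : gel W Y), g $ (rep_u r).1 $ x = h $ (rep_u r).1 $ x) ->
  (forall W (x : gel W X), g $ (rep_u r).2 $ x = h $ (rep_u r).2 $ x) -> g = h.
Proof.
move=> h1 h2; have e0 : k = k + 0 by rewrite addr0.
rewrite -(rep_actK (r := r) e0 g) -(rep_actK (r := r) e0 h); congr rep_inv.
rewrite /= /cone_mact; congr pair; first by apply: act_inj => W x; rewrite !cmpact h1.
by congr (_ *~ _); apply: act_inj => W x; rewrite !cmpact h2.
Qed.

(** [c_rho] is the morphism taking the universal cycle (i, u) to (1, 0). The equation d(i, u) = 0
    contains [c_Du]. Identities between morphisms out of the cone are tested on [i] and [u], by
    [cone_rep_inj]. *)
Lemma cone_rep_data (i : closed_mor Y (rep_ob r)) (p : dhom (rep_ob r) X (-1)) :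
  cval i = (rep_u r).1 ->
  mact (cone_module f) (esym (addr0 (-1))) p (rep_u r) = (0, did X) ->
  inhabited (cone_data f i p).
Proof.
move=> ei ep.
pose u : dhom X (rep_ob r) 1 := (rep_u r).2.
have [p1 p2] : dcmp (esym (addr0 (-1))) p (rep_u r).1 = 0 /\
               dcmp (cone_deg_act (esym (addr0 (-1)))) p u *~ (-1) ^ (-1) = did X.
  by case: ep => -> ->.
have pi W (x : gel W Y) : p $ i $ x = 0.
  by rewrite ei -(cmpact (esym (addr0 (-1)))) p1 zeroact.
have pu W (x : gel W X) : p $ u $ x = - x.
  rewrite -(cmpact (cone_deg_act (esym (addr0 (-1))))) -[x in RHS]idact -p2.
  by rewrite (_ : (-1 : int) ^ (-1) = -1) // mulrN1z oppact opprK.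
pose rho : dhom (rep_ob r) Y 0 := rep_inv r ((did Y, 0) : cone_module f Y 0).
have [r1 r2] : dcmp (esym (addr0 0)) rho (rep_u r).1 = did Y /\
               dcmp (cone_deg_act (esym (addr0 0))) rho u *~ (-1) ^ 0 = 0.
  by have := rep_invK r (esym (addr0 0)) ((did Y, 0) : cone_module f Y 0); case=> -> ->.
have ri W (x : gel W Y) : rho $ i $ x = x.
  by rewrite ei -(cmpact (esym (addr0 0))) r1 idact.
have ru W (x : gel W X) : rho $ u $ x = 0.
  by rewrite -(cmpact (cone_deg_act (esym (addr0 0)))) -[dcmp _ _ _]mulr1z
             -[1]/((-1 : int) ^ 0) r2 zeroact.
have Du W (x : gel W X) : gD (u $ x) = i $ f $ x - u $ gD x.
  have := rep_cycle r deg0_eq; rewrite /= /cone_md => -[_ /eqP].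
  rewrite subr_eq0 => /eqP e.
  rewrite (gD_deg1 (cone_deg_d deg0_eq)) /u -e cmpact.
  by rewrite -ei.
have ir W (x : gel W (rep_ob r)) : i $ rho $ x = x + u $ p $ x.
  pose g : dhom (rep_ob r) (rep_ob r) 0 := cval i ** rho - u ** p.
  suff e : g = did _.
    by have := idact x; rewrite -e /g !actR => {2}<-; rewrite subrK.
  apply: cone_rep_inj => W' y; rewrite !actR -?ei -/u; first by rewrite ri pi !actR subr0.
  by rewrite ru pu !actR sub0r opprK.
have Dp W (x : gel W (rep_ob r)) : gD (p $ x) = - (p $ gD x).
  have e1 : -1 = -2 + 1 :> int by [].
  rewrite (gD_degN1 e1) (_ : dd e1 p = 0) ?zeroact ?sub0r //.
  apply: cone_rep_inj => W' y; rewrite zeroact -?ei -/u.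
    have := gD_degN1 e1 p (i $ y).
    by rewrite pi gD0 gD_closed pi subr0.
  have := gD_degN1 e1 p (u $ y).
  rewrite pu Du !actR pi pu => e; apply: (addrI (- gD y)).
  by rewrite [LHS]addrC {2}e; abel.
have Drho W (x : gel W (rep_ob r)) : gD (rho $ x) = f $ p $ x + rho $ gD x.
  rewrite (gD_deg0 deg0_eq) (_ : dd deg0_eq rho = f ** p) ?cmpact //.
  apply: cone_rep_inj => W' y; rewrite cmpact -?ei -/u.
    rewrite pi act0; have := gD_deg0 deg0_eq rho (i $ y).
    by rewrite gD_closed !ri -[X in X = _]add0r => /addIr.
  rewrite pu; have := gD_deg0 deg0_eq rho (u $ y).
  by rewrite ru Du !actR ri ru subr0 => /esym/eqP; rewrite addr_eq0 => /eqP.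
by constructor; exists u rho.
Qed.

Lemma cone_rep_exists : exists (i : closed_mor Y (rep_ob r)) (p : dhom (rep_ob r) X (-1)),
  [/\ cval i = (rep_u r).1,
    mact (cone_module f) (esym (addr0 (-1))) p (rep_u r) = (0, did X) &
    inhabited (cone_data f i p)].
Proof.
have iP n (e : 0 = n + 1) : dd e (rep_u r).1 = 0.
  by have := rep_cycle r e; rewrite /= /cone_md; case.
pose p := rep_inv r ((0, did X) : cone_module f X (-1)).
have ep := rep_invK r (esym (addr0 (-1))) ((0, did X) : cone_module f X (-1)).
by exists (ClosedMor iP), p; split=> //; apply: cone_rep_data.
Qed.

End ConeRep.

Hypothesis preB : pretriangulated B.

(** Let [v : Q -> Q'] be the invertible cycle of degree -1 into the shift representing B(Q,-)[1].
    Then phi v' is a closed map Q' -> A, and its cone is A (+) Q with differential twisted by [phi].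
    The sign in [q0] offsets the one in [c_pu]. *)
Lemma ext_exists (A Q : B) (phi : dhom Q A (-1)) :
  (forall W (x : gel W Q), gD (phi $ x) = - (phi $ gD x)) ->
  exists (E : B) (i : closed_mor A E) (q : closed_mor E Q) (X : split_ext i q),
    xphi X = phi.
Proof.
have [_ hs hc] := preB => phiP.
have [r] := hs Q 1; have [uP [v' [v'v vv']]] := shift_unit r.
set Q' := rep_ob r in uP v' v'v vv'.
set v : dhom Q Q' (-1) := rep_u r in uP v'v vv'.
have Dv W (x : gel W Q) : gD (v $ x) = - (v $ gD x).
  have e1 : -1 = -2 + 1 :> int by [].
  by rewrite (gD_degN1 e1) uP zeroact sub0r.
have Dv' W (x : gel W Q') : gD (v' $ x) = - (v' $ gD x).
  rewrite -{1}[gD (_ $ x)]v'v; have := Dv _ (v' $ x); rewrite vv' => /eqP.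
  by rewrite -eqr_oppLR => /eqP<-; rewrite actN.
pose f0 : dhom Q' A 0 := phi ** v'.
have f0P W (x : gel W Q') : gD (f0 $ x) = f0 $ gD x.
  by rewrite !cmpact phiP Dv' actN opprK.
pose f := ClosedMor (closed_intro f0P).
have fE W (x : gel W Q') : f $ x = phi $ v' $ x by rewrite cmpact.
have [rC] := hc _ _ f; have [i [p [_ _ [K]]]] := cone_rep_exists rC.
pose q0 : dhom (rep_ob rC) Q 0 := - (v' ** p).
have q0P W (x : gel W (rep_ob rC)) : gD (q0 $ x) = q0 $ gD x.
  by rewrite !actR Dv' (c_Dp K) actN opprK.
pose q := ClosedMor (closed_intro q0P).
have qE W (x : gel W _) : q $ x = - (v' $ p $ x) by rewrite !actR.
pose t : dhom Q (rep_ob rC) 0 := c_u K ** v.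
have X1 W (x : gel W A) : c_rho K $ i $ x = x by rewrite (c_ri K).
have X2 W (x : gel W Q) : q $ t $ x = x.
  by rewrite qE cmpact (c_pu K) actN v'v opprK.
have X3 W (x : gel W _) : i $ c_rho K $ x = x - t $ q $ x.
  by rewrite qE cmpact !actN vv' (c_ir K) opprK.
have X4 W (x : gel W Q) : gD (t $ x) = i $ phi $ x + t $ gD x.
  by rewrite !cmpact (c_Du K) fE v'v Dv actN opprK.
by exists (rep_ob rC), i, q, (@SplitExt _ _ _ _ i q (c_rho K) t phi X1 X2 X3 X4).
Qed.

End Constructions.

(** * Weak equivalences and contractible objects *)

Definition contractible (B : dg_cat) (X : B) : Prop :=
  exists eta : dhom X X 1, forall W (x : gel W X), gD (eta $ x) + eta $ gD x = x.

Section CycleCategory.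
Variable B : dg_cat.

Lemma cycle_eqP (X Y : B) (f g : @hom (cycle_cat B) X Y) :
  f ~= g <-> forall W (x : gel W X), cval f $ x = cval g $ x.
Proof. exact: closed_eqP. Qed.

Lemma cmp_act (W X Y Z : B) (g : @hom (cycle_cat B) Y Z)
    (f : @hom (cycle_cat B) X Y) (x : gel W X) :
  cval (g \o f) $ x = cval g $ cval f $ x.
Proof. exact: cmpact. Qed.

Lemma idm_act (W X : B) (x : gel W X) : cval (@idm (cycle_cat B) X) $ x = x.
Proof. exact: idact. Qed.

Lemma zero_closed (X Y : B) : exists z : closed_mor X Y, forall W (x : gel W X), z $ x = 0.
Proof.
have h W (x : gel W X) : gD ((0 : dhom X Y 0) $ x) = (0 : dhom X Y 0) $ gD x.
  by rewrite !zeroact gD0.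
by exists (ClosedMor (closed_intro h)) => W x; apply: zeroact.
Qed.

(** Z has a single closed endomorphism, so its identity is zero. *)
Lemma zero_gel (Z W : B) (x : gel W Z) :
  @is_initial (cycle_cat B) Z \/ @is_terminal (cycle_cat B) Z -> x = 0.
Proof.
have [z ez] := zero_closed Z Z.
suff h : cval (closed_id Z) = cval z -> x = 0.
  by case=> /(_ Z) [f hf]; apply: h; rewrite (hf (closed_id Z) : cval _ = cval f)
     (hf z : cval _ = cval f).
by move=> e; rewrite -[x]idact -[did Z]/(cval (closed_id Z)) e ez.
Qed.

Lemma gel_zero_ob (O : B) : (forall W (x : gel W O), x = 0) ->
  @is_zero_ob (cycle_cat B) O.
Proof.
move=> h; split=> Y.
  have [z ez] := zero_closed O Y; exists z => g; apply/cycle_eqP => W x.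
  by rewrite (h _ x) !act0.
have [z ez] := zero_closed Y O; exists z => g; apply/cycle_eqP => W x.
by rewrite [LHS]h [RHS]h.
Qed.

Lemma weq_intro (X Y : B) (f : closed_mor X Y) (g : closed_mor Y X)
    (h1 : dhom X X 1) (h2 : dhom Y Y 1) :
  (forall W (x : gel W X), gD (h1 $ x) + h1 $ gD x = g $ f $ x - x) ->
  (forall W (x : gel W Y), gD (h2 $ x) + h2 $ gD x = f $ g $ x - x) ->
  dg_weq f.
Proof.
move=> e1 e2; exists g; split; apply/homologousP.
  by exists h1 => W x; rewrite closed_cmp_act id_act.
by exists h2 => W x; rewrite closed_cmp_act id_act.
Qed.

Lemma weq_elim (X Y : B) (f : closed_mor X Y) : dg_weq f ->
  exists (g : closed_mor Y X) (h1 : dhom X X 1) (h2 : dhom Y Y 1),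
  (forall W (x : gel W X), gD (h1 $ x) + h1 $ gD x = g $ f $ x - x) /\
  (forall W (x : gel W Y), gD (h2 $ x) + h2 $ gD x = f $ g $ x - x).
Proof.
case=> g [/homologousP [h1 e1] /homologousP [h2 e2]].
exists g, h1, h2; split=> W x; rewrite ?e1 ?e2 closed_cmp_act id_act //.
Qed.

Lemma weq_zero_contractible (X Z : B) (w : closed_mor X Z) :
  @is_zero_ob (cycle_cat B) Z -> dg_weq w -> contractible X.
Proof.
move=> hZ /weq_elim [g [h1 [_ [e _]]]]; exists (- h1) => W x.
rewrite !oppact gDN -opprD e (zero_gel (w $ x)) ?act0 ?sub0r ?opprK //.
by left; case: hZ.
Qed.

Section ExtWeq.
Variables (A E Q : B) (i : closed_mor A E) (q : closed_mor E Q) (X : split_ext i q).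

(** The differential of [xt] is i phi, so subtracting i eta phi yields a closed section [t'] of [q].
    The contraction of A also gives the homotopy from t' q to the identity. *)
Lemma ext_weq_q : contractible A -> dg_weq q.
Proof.
case=> eta e.
have De W (x : gel W A) : gD (eta $ x) = x - eta $ gD x by rewrite -[x in x - _]e addrK.
pose t' : dhom Q E 0 := xt X - i ** (eta ** xphi X : dhom Q A 0).
have t'P W (x : gel W Q) : gD (t' $ x) = t' $ gD x.
  by rewrite !actR !(extR X) De !actR !(extR X) !actR; abel.
pose h : dhom E E 1 := - (i ** (eta ** xs X : dhom E A 1)).
apply: (@weq_intro _ _ q (ClosedMor (closed_intro t'P)) h 0) => W x /=.
  rewrite !actR !De !(extR X) !actR !(extR X); abel.
by rewrite !actR !(extR X); abel.
Qed.

(** Dually to [ext_weq_q], the contraction of Q corrects the retraction [xs], whose differential is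
    - phi q, to a closed one. *)
Lemma ext_retraction : contractible Q ->
  exists (r : closed_mor E A), (forall W (x : gel W A), r $ i $ x = x) /\ dg_weq i.
Proof.
case=> eta e.
have De W (x : gel W Q) : gD (eta $ x) = x - eta $ gD x by rewrite -[x in x - _]e addrK.
pose r : dhom E A 0 := xs X - (xphi X ** eta : dhom Q A 0) ** q.
have rP W (x : gel W E) : gD (r $ x) = r $ gD x.
  by rewrite !actR !(extR X) De !actR; abel.
exists (ClosedMor (closed_intro rP)); split=> [W x /=|].
  by rewrite !actR !(extR X) !actR; abel.
pose h : dhom E E 1 := - ((xt X ** eta : dhom Q E 1) ** q)
  - (i ** (xphi X ** (eta ** eta : dhom Q Q 2) : dhom Q A 1) : dhom Q E 1) ** q.
apply: (@weq_intro _ _ i (ClosedMor (closed_intro rP)) 0 h) => W x /=.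
  by rewrite !actR !(extR X) !actR; abel.
by rewrite !actR ?De ?(extR X) ?actR ?De ?(extR X) ?actR ?De ?actR; abel.
Qed.

(* The null-homotopy of [q] is corrected to vanish on [A], and then factors
   through [q]. *)
Lemma weq_ext_contractible : dg_weq i -> contractible Q.
Proof.
case/weq_elim=> g [w [h [ew eh]]].
have Dw W (x : gel W A) : gD (w $ x) = g $ i $ x - x - w $ gD x.
  by rewrite -ew addrK.
have Dh W (x : gel W E) : gD (h $ x) = i $ g $ x - x - h $ gD x.
  by rewrite -eh addrK.
pose eta : dhom Q Q 1 := - ((q ** h : dhom E Q 1) ** xt X)
  + ((q ** h : dhom E Q 1) ** i) ** (g ** xt X - (w ** xphi X : dhom Q A 0)).
exists eta => W x.
by rewrite !actR ?Dh ?Dw ?(extR X) ?actR ?Dh ?Dw ?(extR X) ?actR; abel.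
Qed.

End ExtWeq.
End CycleCategory.

(** * Pushouts and quotients *)

Section Pushouts.
Variable B : dg_cat.
Implicit Types A D E Q P : B.

(* The splittings of [X : split_ext i q] and [Y : split_ext j q'] are compatible
   along the pushout square (i, f, k, j). *)
Definition ext_pushout A E Q D P (i : closed_mor A E) (q : closed_mor E Q)
    (f : closed_mor A D) (k : closed_mor E P) (j : closed_mor D P)
    (q' : closed_mor P Q) (X : split_ext i q) (Y : split_ext j q') : Prop :=
  [/\ forall W (x : gel W Q), xphi Y $ x = f $ xphi X $ x,
      forall W (x : gel W E), q' $ k $ x = q $ x,
      forall W (x : gel W Q), k $ xt X $ x = xt Y $ x &
      forall W (x : gel W E), xs Y $ k $ x = f $ xs X $ x].

Lemma pushout_act A E D P (i : @hom (cycle_cat B) A E) (f : @hom (cycle_cat B) A D)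
    k (j : @hom (cycle_cat B) D P) : is_pushout i f k j ->
  forall W (x : gel W A), cval k $ cval i $ x = cval j $ cval f $ x.
Proof. by move=> [/cycle_eqP e _] W x; rewrite -!cmp_act e. Qed.

(** As P = D (+) Q, the induced map has to be [j'] on D and k' t on Q. That it is closed is the
    equation k' i = j' f composed with [xphi X]. *)
Lemma ext_is_pushout A E Q D P (i : closed_mor A E) (q : closed_mor E Q)
    (f : closed_mor A D) (k : closed_mor E P) (j : closed_mor D P)
    (q' : closed_mor P Q) (X : split_ext i q) (Y : split_ext j q') :
  ext_pushout f k X Y -> @is_pushout (cycle_cat B) A E D P i f k j.
Proof.
move=> [e1 e2 e3 e4].
have e5 W (x : gel W A) : k $ i $ x = j $ f $ x.
  have := x_is Y (k $ i $ x); rewrite e4 e2 !(extR X) !actR subr0 => -> //.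
split; first by apply/cycle_eqP => W x; rewrite !cmp_act e5.
move=> R k' j' /cycle_eqP ekj.
have {}ekj W (x : gel W A) : cval k' $ i $ x = cval j' $ f $ x.
  by rewrite -!cmp_act ekj.
pose u : dhom P R 0 := cval j' ** xs Y + (cval k' ** xt X) ** q'.
have uP W (x : gel W P) : gD (u $ x) = u $ gD x.
  by rewrite !actR (x_Dt X) (x_Ds Y) !actR e1 ekj; abel.
exists (ClosedMor (closed_intro uP)).
  split; apply/cycle_eqP => W x; rewrite cmp_act /= !actR.
    by rewrite e4 e2 -ekj (x_is X) actD actN subrK.
  by rewrite !(extR Y) !act0 addr0.
move=> u' /cycle_eqP ek /cycle_eqP ej; apply/cycle_eqP => W x /=.
rewrite -[x in LHS](subrK (xt Y $ q' $ x)) -(x_is Y) actD -e3.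
by rewrite -[X in X + _]cmp_act ej -[X in _ + X]cmp_act ek !actR.
Qed.

Hypothesis preB : pretriangulated B.

Lemma pushout_exists A E Q D (i : closed_mor A E) (q : closed_mor E Q)
    (X : split_ext i q) (f : closed_mor A D) :
  exists (P : B) (k : closed_mor E P) (j : closed_mor D P) (q' : closed_mor P Q)
    (Y : split_ext j q'), ext_pushout f k X Y.
Proof.
have fphi W (x : gel W Q) :
    gD ((cval f ** xphi X : dhom Q D (-1)) $ x) =
    - ((cval f ** xphi X : dhom Q D (-1)) $ gD x).
  by rewrite !actR (x_Dphi X) actN.
have [P [j [q' [Y eY]]]] := ext_exists preB fphi.
pose k : dhom E P 0 := (cval j ** f : dhom A P 0) ** xs X + xt Y ** q.
have phiE W (x : gel W Q) : xphi Y $ x = f $ xphi X $ x by rewrite eY cmpact.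
have kP W (x : gel W E) : gD (k $ x) = k $ gD x.
  by rewrite !actR !(extR X) !(extR Y) phiE !actR; abel.
exists P, (ClosedMor (closed_intro kP)), j, q', Y; split=> W x //=.
- by rewrite !actR !(extR Y) add0r.
- by rewrite !actR !(extR X) !act0 add0r.
- by rewrite !actR !(extR Y) addr0.
Qed.

(** The definitions of quotient, cone extension and connecting morphism speak of arbitrary pushouts;
    the splitting is carried over from the constructed one along the comparison isomorphism. *)
Lemma pushout_ext A E Q D P (i : closed_mor A E) (q : closed_mor E Q)
    (X : split_ext i q) (f : closed_mor A D) (k : closed_mor E P) (j : closed_mor D P) :
  @is_pushout (cycle_cat B) A E D P i f k j ->
  exists (q' : closed_mor P Q) (Y : split_ext j q'), ext_pushout f k X Y.
Proof.
have [P' [k' [j' [q' [Y eY]]]]] := pushout_exists X f.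
move=> po; have po' := ext_is_pushout eY.
have [u [v [[/cycle_eqP vu /cycle_eqP uv] [/cycle_eqP uk /cycle_eqP uj
  /cycle_eqP vk /cycle_eqP vj]]]] := pushout_unique po po'.
have [e1 e2 e3 e4] := eY.
have {}vu W (x : gel W P) : cval v $ cval u $ x = x by rewrite -cmp_act (vu W) idm_act.
have {}uv W (x : gel W P') : cval u $ cval v $ x = x by rewrite -cmp_act (uv W) idm_act.
have {}uk W (x : gel W E) : cval u $ k $ x = k' $ x by rewrite -cmp_act (uk W).
have {}uj W (x : gel W D) : cval u $ j $ x = j' $ x by rewrite -cmp_act (uj W).
have {}vk W (x : gel W E) : cval v $ k' $ x = k $ x by rewrite -cmp_act (vk W).
have {}vj W (x : gel W D) : cval v $ j' $ x = j $ x by rewrite -cmp_act (vj W).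
pose s : dhom P D 0 := xs Y ** cval u.
pose t : dhom Q P 0 := cval v ** xt Y.
pose q2 := closed_cmp q' u.
have X1 W (x : gel W D) : s $ j $ x = x by rewrite cmpact uj (extR Y).
have X2 W (x : gel W Q) : q2 $ t $ x = x by rewrite !actR uv (extR Y).
have X3 W (x : gel W P) : j $ s $ x = x - t $ q2 $ x.
  by rewrite !actR -vj (extR Y) !actR vu.
have X4 W (x : gel W Q) : gD (t $ x) = j $ xphi Y $ x + t $ gD x.
  by rewrite !actR (extR Y) actD vj.
exists q2, (SplitExt X1 X2 X3 X4); split=> W x /=.
- exact: e1.
- by rewrite !actR uk e2.
- by rewrite -vk e3 cmpact.
- by rewrite cmpact uk e4.
Qed.

(** The pushout is an extension of [Q0] by a zero object, so [q' : Q -> Q0] is an isomorphism with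
    inverse [xt Y]. The splitting with quotient [Q0] is transported along it. *)
Lemma quotient_ext A E (i : closed_mor A E) Q (q : closed_mor E Q) :
  dg_cof i -> @is_quotient (cycle_cat B) A E Q i q -> exists X : split_ext i q, True.
Proof.
move=> /cof_ext [Q0 [q0 [X]]] [Z [a [z [hZ po]]]].
have [q' [Y [e1 e2 e3 e4]]] := pushout_ext X po.
have zZ W (x : gel W Z) : x = 0 by apply: zero_gel; left; case: hZ.
have tq W (x : gel W Q) : xt Y $ q' $ x = x.
  by have /esym/eqP := x_is Y x; rewrite (zZ _ (xs _ $ _)) act0 subr_eq0 => /eqP.
pose t : dhom Q E 0 := xt X ** q'; pose phi : dhom Q A (-1) := xphi X ** q'.
have X1 W (x : gel W A) : xs X $ i $ x = x by rewrite (extR X).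
have X2 W (x : gel W Q) : q $ t $ x = x by rewrite cmpact e3 tq.
have X3 W (x : gel W E) : i $ xs X $ x = x - t $ q $ x.
  by rewrite cmpact e2 (extR X).
have X4 W (x : gel W Q) : gD (t $ x) = i $ phi $ x + t $ gD x.
  by rewrite !actR (extR X) gD_closed.
by exists (SplitExt X1 X2 X3 X4).
Qed.

Lemma zero_ob_exists : exists O : B, @is_zero_ob (cycle_cat B) O.
Proof.
have [[O hO] _ _] := preB; exists O; apply: gel_zero_ob => W x.
by apply: gelP => k; have [_] := hO W k; apply.
Qed.

Lemma ext_quotient A E (i : closed_mor A E) Q (q : closed_mor E Q) :
  split_ext i q -> @is_quotient (cycle_cat B) A E Q i q.
Proof.
move=> X; have [O hO] := zero_ob_exists.
have zO W (x : gel W O) : x = 0 by apply: zero_gel; left; case: hO.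
have [a ea] := zero_closed A O; have [z ez] := zero_closed O Q.
exists O, a, z; split=> //; split.
  by apply/cycle_eqP => W x; rewrite !cmp_act (extR X) ez.
move=> R k' j' /cycle_eqP e.
have {}e W (x : gel W A) : cval k' $ i $ x = 0.
  by rewrite -cmp_act e cmp_act ea act0.
pose u : dhom Q R 0 := cval k' ** xt X.
have uP W (x : gel W Q) : gD (u $ x) = u $ gD x.
  by rewrite !actR (extR X) actD e add0r.
exists (ClosedMor (closed_intro uP)).
  split; apply/cycle_eqP => W x; rewrite cmp_act /= !actR.
    by rewrite -[x in RHS](subrK (xt X $ q $ x)) -(x_is X) actD e add0r.
  by rewrite (zO _ x) !act0.
move=> u' /cycle_eqP eu _; apply/cycle_eqP => W x /=; rewrite cmpact.
by rewrite -eu cmp_act (extR X).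
Qed.

(** E is the mapping cylinder of [f]. The map [w] is [f] on A and [c_rho] on C, with homotopy
    inverse xt i. The homotopy between i w and [q] serves to compare the triangle of the cone with
    that of the extension. *)
Lemma factor_cone A D C (f : closed_mor A D) (i : closed_mor D C)
    (p : dhom C A (-1)) (K : cone_data f i p) :
  exists (E : B) (j : closed_mor A E) (q : closed_mor E C) (w : closed_mor E D)
    (X : split_ext j q),
  [/\ forall W (x : gel W A), w $ j $ x = f $ x, dg_weq w,
      forall W (x : gel W C), xphi X $ x = p $ x &
      homologous (closed_cmp i w) q].
Proof.
have pP W (x : gel W C) : gD (p $ x) = - (p $ gD x) by rewrite (c_Dp K).
have [E [j [q [X eX]]]] := ext_exists preB pP.
have eX' W (x : gel W C) : xphi X $ x = p $ x by rewrite eX.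
pose w : dhom E D 0 := c_rho K ** q + cval f ** xs X.
have wP W (x : gel W E) : gD (w $ x) = w $ gD x.
  by rewrite !actR !(coneR K) !(extR X) eX' !actR; abel.
pose v : dhom D E 0 := xt X ** i.
have vP W (x : gel W D) : gD (v $ x) = v $ gD x.
  by rewrite !actR !(extR X) eX' !actR !(coneR K) !actR add0r.
exists E, j, q, (ClosedMor (closed_intro wP)), X; split=> // [W x||].
- by rewrite /= !actR !(extR X) act0 add0r.
- pose h : dhom E E 1 := (xt X ** c_u K : dhom A E 1) ** xs X.
  apply: (@weq_intro _ _ _ _ (ClosedMor (closed_intro vP)) h 0) => W x /=.
    rewrite !actR !(extR X, eX', coneR K, actR); abel.
  by rewrite !actR !(extR X, eX', coneR K, actR); abel.
- apply/homologousP; exists (c_u K ** xs X : dhom E C 1) => W x.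
  by rewrite /= !actR !(extR X, eX', coneR K, actR); abel.
Qed.

End Pushouts.

(** * The cofibration category *)

Section CofibrationCategory.
Variable B : dg_cat.
Hypothesis preB : pretriangulated B.

Lemma ext_eqm (A E Q : B) (i i' : closed_mor A E) (q q' : closed_mor E Q) :
  (forall W (x : gel W A), i $ x = i' $ x) ->
  (forall W (x : gel W E), q $ x = q' $ x) -> split_ext i q -> split_ext i' q'.
Proof.
move=> ei eq X; apply: (@SplitExt B A E Q i' q' (xs X) (xt X) (xphi X)) => W x;
  by rewrite -?ei -?eq (extR X).
Qed.

Lemma iso_ext (A E O : B) (i : @hom (cycle_cat B) A E) (q : closed_mor E O) :
  is_iso i -> @is_zero_ob (cycle_cat B) O -> inhabited (split_ext i q).
Proof.
move=> [g [/cycle_eqP gi /cycle_eqP ig]] hO.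
have zO W (x : gel W O) : x = 0 by apply: zero_gel; left; case: hO.
constructor; apply: (@SplitExt B A E O i q (cval g) 0 0) => W x.
- by rewrite -cmp_act gi idm_act.
- by rewrite (zO _ x) !act0.
- by rewrite -cmp_act ig idm_act zeroact subr0.
- by rewrite !actR addr0.
Qed.

Lemma iso_dg_cof (A E : B) (i : @hom (cycle_cat B) A E) : is_iso i -> dg_cof i.
Proof.
move=> hi; have [O hO] := zero_ob_exists preB.
have [z _] := zero_closed E O.
by apply/cof_ext; exists O, z; apply: iso_ext.
Qed.

Lemma homology_eqm (X Y : B) (f g : closed_mor X Y) :
  @eqm (cycle_cat B) X Y f g -> @eqm (homology_cat B) X Y f g.
Proof. exact: closed_eq_homologous. Qed.

Lemma iso_dg_weq (A E : B) (i : @hom (cycle_cat B) A E) : is_iso i -> dg_weq i.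
Proof. by move=> [g [h1 h2]]; exists g; split; apply: homology_eqm. Qed.

(** The quotient F/A is the pushout P of [j] along [q1 : E -> Q1], itself an extension of [Q2] by
    [Q1]; the splitting over P is assembled from the two given ones. *)
Lemma dg_cof_cmp (A E F : B) (i : closed_mor A E) (j : closed_mor E F) :
  dg_cof i -> dg_cof j -> dg_cof (closed_cmp j i).
Proof.
move=> /cof_ext [Q1 [q1 [X1]]] /cof_ext [Q2 [q2 [X2]]].
have [P [k [l [q' [Y [e1 e2 e3 e4]]]]]] := pushout_exists preB X2 q1.
apply/cof_ext; exists P, k.
have tk W (x : gel W F) :
    xt X2 $ q' $ k $ x + j $ xt X1 $ xs Y $ k $ x = x - j $ i $ xs X1 $ xs X2 $ x.
  by rewrite e2 e4 (extR X1) !actR; rewrite (extR X2); abel.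
pose s : dhom F A 0 := xs X1 ** xs X2.
pose t : dhom P F 0 := xt X2 ** q' + (cval j ** xt X1 : dhom Q1 F 0) ** xs Y.
pose phi : dhom P A (-1) := xphi X1 ** xs Y
  + (xs X1 ** xphi X2 : dhom Q2 A (-1)) ** q'.
constructor; apply: (@SplitExt B A F P _ _ s t phi) => W x.
- by rewrite !actR (extR X2) (extR X1).
- rewrite !actR e3.
  have kj V (y : gel V E) : k $ j $ y = l $ q1 $ y.
    by exact: (pushout_act (ext_is_pushout (And4 e1 e2 e3 e4))).
  by rewrite kj (extR X1) -[RHS](subrK (xt Y $ q' $ x)) -(x_is Y) addrC.
- by rewrite !actR tk; abel.
- by rewrite !(actR, extR X2, extR Y, extR X1, e1); abel.
Qed.

Lemma cofibration_category_cycle : cofibration_category (cycle_cof_data B).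
Proof.
have ext0 (X Y O : B) (f : closed_mor X Y) : @is_initial (cycle_cat B) X -> dg_cof f.
  move=> hX; have zX W (x : gel W X) : x = 0 by apply: zero_gel; left.
  apply/cof_ext; exists Y, (closed_id Y); constructor.
  apply: (@SplitExt B X Y Y f (closed_id Y) 0 (did Y) 0) => W x; rewrite !actR //.
  - by rewrite subrr.
  - by rewrite add0r.
split.
- move=> A E f g /= /cycle_eqP e /cof_ext [Q [q [X]]]; apply/cof_ext.
  by exists Q, q; constructor; apply: ext_eqm e _ X.
- by move=> A E f g e; apply: is_iso_eqm; apply: homology_eqm.
- exact: iso_dg_cof.
- exact: iso_dg_weq.
- by move=> A E D g f hg hf; apply: dg_cof_cmp.
- by have [O [hO _]] := zero_ob_exists preB; exists O.
- by move=> X Y f; apply: ext0.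
- by move=> A E D g f hf hg; apply: (@is_iso_cmp (homology_cat B)).
- by move=> A E D g f; apply: (@is_iso_cancel_l (homology_cat B)).
- by move=> A E D g f; apply: (@is_iso_cancel_r (homology_cat B)).
- move=> A E D i f /cof_ext [Q [q [X]]].
  have [P [k [j [q' [Y eY]]]]] := pushout_exists preB X f.
  exists P, k, j; split; first exact: ext_is_pushout eY.
    by apply/cof_ext; exists Q, q'.
  (* Both inclusions have the same quotient Q, and its contractibility passes from one to the
     other. *)
  by move=> /(weq_ext_contractible X) /(ext_retraction Y) [r [_ ?]].
- move=> A D f; have [_ _ /(_ _ _ f) [r]] := preB.
  have [i [p [_ _ [K]]]] := cone_rep_exists r.
  have [E [j [q [w [X [e1 e2 e3 _]]]]]] := factor_cone preB K.
  exists E, j, w; split=> //.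
    by apply/cof_ext; exists (rep_ob r), q.
  by apply/cycle_eqP => W x; rewrite cmp_act e1.
Qed.

Lemma fibrant_cycle (X : cycle_cof_data B) : fibrant X.
Proof.
move=> Y i /cof_ext [Q [q [Z]]] /(weq_ext_contractible Z) /(ext_retraction Z).
move=> [r [e _]]; exists r; apply/cycle_eqP => W x.
by rewrite cmp_act e idm_act.
Qed.

Lemma pointed_cycle : pointed (cycle_cof_data B).
Proof.
move=> X hX; have zX W (x : gel W X) : x = 0 by apply: zero_gel; left.
by have [] := gel_zero_ob zX.
Qed.

End CofibrationCategory.

(** * Localization and homology category *)

Section HomotopyCategory.
Variable B : dg_cat.
Hypothesis preB : pretriangulated B.

Notation ZB := (cycle_cof_data B).
Notation H := (homology_cat B).

(** The ends of X (+) Cone(id) differ by the inclusion of X into its cone, and the projection to X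
    is closed because the extension has [xphi] zero. A homotopy [h] from [f] to [g] amounts to an
    extension of f - g over the cone, namely (f - g) rho - h p. *)
Lemma cylinder (X Y : B) (f g : closed_mor X Y) : homologous f g ->
  exists (E : B) (j1 j2 : @hom (cycle_cat B) X E) (pr : @hom (cycle_cat B) E X)
    (h : @hom (cycle_cat B) E Y),
    [/\ dg_weq pr, pr \o j1 ~= pr \o j2, h \o j1 ~= f & h \o j2 ~= g].
Proof.
move=> /homologousP [h eh].
have Dh W (x : gel W X) : gD (h $ x) = f $ x - g $ x - h $ gD x.
  by rewrite -eh addrK.
have [_ _ /(_ _ _ (closed_id X)) [r]] := preB.
have [i [p [_ _ [K]]]] := cone_rep_exists r.
have zP W (x : gel W (rep_ob r)) :
    gD ((0 : dhom _ X (-1)) $ x) = - ((0 : dhom (rep_ob r) X (-1)) $ gD x).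
  by rewrite !actR oppr0.
have [E [j [q [S eS]]]] := ext_exists preB zP.
have {}eS W (x : gel W _) : xphi S $ x = 0 by rewrite eS zeroact.
have prP W (x : gel W E) : gD (xs S $ x) = xs S $ gD x.
  by rewrite (extR S) eS oppr0 add0r.
pose pr := ClosedMor (closed_intro prP).
pose j1 : dhom X E 0 := cval j + xt S ** i.
have j1P W (x : gel W X) : gD (j1 $ x) = j1 $ gD x.
  by rewrite !(actR, extR S, eS) add0r.
pose k : dhom (rep_ob r) Y 0 := (cval f - cval g) ** c_rho K - h ** p.
pose hh : dhom E Y 0 := cval g ** xs S + k ** q.
have hhP W (x : gel W E) : gD (hh $ x) = hh $ gD x.
  rewrite !(actR, extR S, eS, coneR K, Dh); abel.
exists E, (ClosedMor (closed_intro j1P)), j, pr, (ClosedMor (closed_intro hhP)).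
split.
- pose w : dhom E E 1 := - ((xt S ** c_u K) ** (c_rho K ** q : dhom E X 0)).
  apply: (@weq_intro _ _ _ pr j w 0) => W x /=.
    by rewrite !(actR, extR S, eS, coneR K); abel.
  by rewrite !(actR, extR S, eS, coneR K); abel.
- apply/cycle_eqP => W x; rewrite !cmp_act /= !(actR, extR S); abel.
- apply/cycle_eqP => W x; rewrite !cmp_act /= !(actR, extR S, coneR K); abel.
- apply/cycle_eqP => W x; rewrite !cmp_act /= !(actR, extR S, coneR K); abel.
Qed.

Lemma gamma_homologous (X Y : B) (f g : closed_mor X Y) :
  homologous f g -> @eqm (Ho ZB) X Y (@loc_of ZB (@weq ZB) X Y f) (@loc_of ZB (@weq ZB) X Y g).
Proof.
move=> /cylinder [E [j1 [j2 [pr [h [wpr ej ef eg]]]]]].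
pose G X' Y' (a : @hom (cycle_cat B) X' Y') : @hom (Ho ZB) X' Y' :=
  fmap (@gamma ZB) a.
have GM X1 X2 X3 (a : @hom (cycle_cat B) X2 X3) (b : @hom (cycle_cat B) X1 X2) :
  G _ _ (a \o b) ~= G _ _ a \o G _ _ b by exact: (fmap_cmp (@gamma ZB)).
have GE X' Y' (a b : @hom (cycle_cat B) X' Y') : a ~= b -> G _ _ a ~= G _ _ b.
  exact: (@fmap_eqm _ _ (@gamma ZB)).
have isoG : is_iso (G _ _ pr).
  exists (@loc_inv ZB (@weq ZB) E X pr wpr); split.
    exact: loc_eq_inv_l.
  exact: loc_eq_inv_r.
have ej' : G _ _ j1 ~= G _ _ j2.
  by apply: (iso_monic isoG); rewrite -!GM; apply: GE.
transitivity (G _ _ h \o G _ _ j1).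
  by rewrite -GM; apply: GE; symmetry.
by rewrite ej' -GM; apply: GE.
Qed.

(** A morphism of H(B) is a closed morphism, not a class, so a homotopy inverse has to be chosen for
    every formal inverse. *)
Fixpoint ho_val (X Y : ZB) (f : loc_hom (@weq ZB) X Y) : @closed_mor B X Y :=
  match f with
  | loc_of _ _ g => g
  | loc_inv _ _ _ Ww => sval (cid Ww)
  | loc_cmp _ _ _ g f => closed_cmp (ho_val g) (ho_val f)
  end.

Lemma ho_val_eqm (X Y : ZB) (f g : loc_hom (@weq ZB) X Y) :
  loc_eq f g -> @eqm H X Y (ho_val f) (ho_val g).
Proof.
elim=> {X Y f g} /=.
- by move=> X Y f; apply: (@eqm_refl H).
- by move=> X Y f g _; apply: (@eqm_sym H).
- by move=> X Y f g h _ e1 _; apply: (@eqm_trans H _ _ _ _ _ e1).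
- by move=> X Y Z g g' f f' _ e1 _ e2; apply: (@cmp_eqm H).
- by move=> X Y Z V h g f; apply: (@cmp_assoc H).
- by move=> X Y f; apply: (@cmp_id_l H).
- by move=> X Y f; apply: (@cmp_id_r H).
- by move=> X Y f g; apply: homology_eqm.
- by move=> X Y Z g f; apply: (@eqm_refl H).
- by move=> X Y w Ww; case: (cid Ww) => g [].
- by move=> X Y w Ww; case: (cid Ww) => g [].
Qed.

Definition ho_functor : functor (Ho ZB) H :=
  @Functor (Ho ZB) H id ho_val ho_val_eqm
    (fun X => eqm_refl (@idm H X))
    (fun X Y Z g f => eqm_refl (closed_cmp (ho_val g) (ho_val f) : @hom H X Z)).

Definition ho_of (X Y : B) (f : closed_mor X Y) : @hom (Ho ZB) X Y :=
  @loc_of ZB (@weq ZB) X Y f.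

Definition ho_inverse : functor H (Ho ZB) :=
  @Functor H (Ho ZB) id ho_of gamma_homologous
    (fun X => eqm_refl (@idm (Ho ZB) X))
    (fun X Y Z g f => @fmap_cmp _ _ (@gamma ZB) X Y Z g f).

(** In the localization, the chosen homotopy inverse and the formal inverse are both inverse to the
    image of [w], since homotopic maps agree there. *)
Lemma ho_ofK (X Y : ZB) (f : @hom (Ho ZB) X Y) : ho_of (ho_val f) ~= f.
Proof.
elim: f => {X Y} [X Y f|X Y w Ww|X Y Z g eg f ef].
- exact: (@eqm_refl (Ho ZB)).
- have [w1 w2] : are_inverse (w : @hom H X Y) (ho_val (loc_inv Ww)).
    by rewrite /=; case: (cid Ww).
  have isoW : is_iso (ho_of w).
    by exists (loc_inv Ww); split; [apply: loc_eq_inv_l | apply: loc_eq_inv_r].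
  apply: (iso_monic isoW); apply: (@eqm_trans _ _ _ (@idm (Ho ZB) Y)).
    apply: eqm_trans (fmap_eqm ho_inverse w2).
    exact: eqm_sym (fmap_cmp ho_inverse _ _).
  by apply: eqm_sym; apply: loc_eq_inv_r.
- apply: eqm_trans (cmp_eqm eg ef).
  exact: (fmap_cmp ho_inverse (ho_val g) (ho_val f)).
Qed.

Lemma ho_val_inj (X Y : ZB) (f g : @hom (Ho ZB) X Y) :
  @eqm H X Y (ho_val f) (ho_val g) -> f ~= g.
Proof.
by move=> e; rewrite -(ho_ofK f) -(ho_ofK g); apply: (fmap_eqm ho_inverse e).
Qed.

Lemma ho_functor_equivalence : is_equivalence ho_functor.
Proof.
apply: ff_equivalence => [X Y f g|X Y h|Y].
- exact: ho_val_inj.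
- by exists (ho_of h).
- by exists Y, (idm Y); apply: (@is_iso_id H).
Qed.

Lemma ho_inverse_equivalence : is_equivalence ho_inverse.
Proof.
apply: ff_equivalence => [X Y f g|X Y h|Y].
- exact: (@ho_val_eqm X Y (ho_of f) (ho_of g)).
- by exists (ho_val h); apply: ho_ofK.
- by exists Y, (idm Y); apply: (@is_iso_id (Ho ZB)).
Qed.

End HomotopyCategory.

(** * The shift functor and boundary maps *)

Section Shift.
Variables (B : dg_cat) (sigma : shift_choice B).

Notation H := (homology_cat B).
Notation T := (shift_functor sigma).

Definition sh (X : B) : B := rep_ob (sigma X).
(** The universal cycle has degree [0 - -1], which computes to 1. *)
Definition su (X : B) : dhom X (sh X) 1 := rep_u (sigma X).

Lemma su_D W X (x : gel W X) : gD (su X $ x) = - (su X $ gD x).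
Proof.
have [uP _] := shift_unit (sigma X).
rewrite (gD_deg1 (esym (add0r 1))) (_ : dd _ (su X) = 0) ?zeroact; first by abel.
exact: uP.
Qed.

Lemma su_inverse X : exists v : dhom (sh X) X (-1),
  [/\ forall W (x : gel W X), v $ su X $ x = x,
      forall W (x : gel W (sh X)), su X $ v $ x = x &
      forall W (x : gel W (sh X)), gD (v $ x) = - (v $ gD x)].
Proof.
have [_ [v [vu uv]]] := shift_unit (sigma X).
rewrite -/(su X) in vu uv; exists v; split=> // W x.
by have := su_D (v $ x); rewrite uv => ->; rewrite actN opprK vu.
Qed.

Lemma shift_mor_su X Y (f : closed_mor X Y) W (x : gel W X) :
  shift_mor sigma f $ su X $ x = su Y $ f $ x.
Proof.
have e := shift_valE sigma f (esym (add0r _)) (esym (addr0 _)).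
by rewrite -(cmpact (esym (add0r (0 - -1)))) e cmpact.
Qed.

(** A homotopy between the shifted maps is conjugated back by [su] and its inverse; the sign arises
    because [v] has odd degree. *)
Lemma shift_faithful X Y (f g : @hom H X Y) : fmap T f ~= fmap T g -> f ~= g.
Proof.
move=> /homologousP [h eh]; have [v [vu uv Dv]] := su_inverse Y.
apply/homologousP; exists (- ((v ** h : dhom (sh X) Y 0) ** su X)) => W x.
have := eh W (su X $ x); rewrite /= !shift_mor_su su_D => /(congr1 (fun y => v $ y)).
rewrite !actR !vu => <-.
by rewrite Dv; abel.
Qed.

Lemma shift_full X Y (h : @hom H (T X) (T Y)) : exists f : @hom H X Y, fmap T f ~= h.
Proof.
have [v [vu uv Dv]] := su_inverse Y; have [v' [vu' uv' Dv']] := su_inverse X.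
pose f : dhom X Y 0 := (v ** cval h : dhom (sh X) Y (-1)) ** su X.
have fP W (x : gel W X) : gD (f $ x) = f $ gD x.
  by rewrite !cmpact Dv gD_closed su_D !actN opprK.
exists (ClosedMor (closed_intro fP)); apply: homology_eqm; apply/cycle_eqP => W x.
by rewrite -[x]uv' [LHS]shift_mor_su /= !cmpact uv.
Qed.

(** X is Y[-1], which represents B(Y,-)[1]; the invertible cycles between Y, X and X[1] compose to
    an isomorphism of degree 0. *)
Lemma shift_surj (Y : B) : representable (shift_module Y 1) ->
  exists (X : H) (h : @hom H (T X) Y), is_iso h.
Proof.
move=> [r]; have [uP [v1 [vu1 uv1]]] := shift_unit r.
set X := rep_ob r in v1 uP vu1 uv1; set u1 : dhom Y X (-1) := rep_u r in vu1 uv1 uP.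
have e1 : -1 = -2 + 1 :> int by [].
have Du1 W (x : gel W Y) : gD (u1 $ x) = - (u1 $ gD x).
  by rewrite (gD_degN1 e1) (_ : dd _ u1 = 0) ?zeroact; [abel | exact: uP].
have Dv1 W (x : gel W X) : gD (v1 $ x) = - (v1 $ gD x).
  by rewrite -[LHS]vu1 -{2}[x]uv1 Du1 actN opprK.
have [v [vu uv Dv]] := su_inverse X.
pose f : dhom (sh X) Y 0 := v1 ** v; pose g : dhom Y (sh X) 0 := su X ** u1.
have fP W (x : gel W (sh X)) : gD (f $ x) = f $ gD x.
  by rewrite !cmpact Dv1 Dv actN opprK.
have gP W (x : gel W Y) : gD (g $ x) = g $ gD x.
  by rewrite !cmpact su_D Du1 actN opprK.
exists X, (ClosedMor (closed_intro fP)), (ClosedMor (closed_intro gP)).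
split; apply: homology_eqm; apply/cycle_eqP => W x;
  by rewrite !cmp_act idm_act /= !cmpact ?vu1 ?uv ?vu ?uv1.
Qed.

Section Boundary.
Variables (A E Q : B) (i : closed_mor A E) (q : closed_mor E Q) (X : split_ext i q).

Definition connecting_val : dhom Q (sh A) 0 := su A ** xphi X.

Lemma connecting_closed W (x : gel W Q) : gD (connecting_val $ x) = connecting_val $ gD x.
Proof. by rewrite !cmpact su_D (extR X) actN opprK. Qed.

Lemma boundary_closed W (x : gel W Q) :
  gD ((- connecting_val) $ x) = (- connecting_val) $ gD x.
Proof. by rewrite !oppact gDN connecting_closed. Qed.

Definition connecting : closed_mor Q (sh A) := ClosedMor (closed_intro connecting_closed).
(** The sign is the one for which the suspension comparison turns the connecting morphism into
    [connecting] itself; see [connecting_theta]. *)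
Definition boundary : closed_mor Q (sh A) := ClosedMor (closed_intro boundary_closed).

Lemma connecting_act W (x : gel W Q) : connecting $ x = su A $ xphi X $ x.
Proof. exact: cmpact. Qed.
Lemma boundary_act W (x : gel W Q) : boundary $ x = - (su A $ xphi X $ x).
Proof. by rewrite oppact cmpact. Qed.

(** The inverse lifts from A[1] to A, includes into E, contracts there and projects to Q: up to sign
    it is q eta i v. *)
Lemma boundary_iso : contractible E -> @is_iso H Q (sh A) boundary.
Proof.
move=> [eta e]; have [v [vu uv Dv]] := su_inverse A.
have De W (x : gel W E) : gD (eta $ x) = x - eta $ gD x.
  by rewrite -[x in x - _]e addrK.
pose g : dhom (sh A) Q 0 := - (((q ** eta : dhom E Q 1) ** i) ** v).
have gP W (x : gel W (sh A)) : gD (g $ x) = g $ gD x.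
  by rewrite !(actR, De, Dv, extR X); abel.
pose h1 : dhom Q Q 1 := - ((q ** eta : dhom E Q 1) ** xt X).
pose h2 : dhom (sh A) (sh A) 1 :=
  su A ** (((xs X ** eta : dhom E A 1) ** i) ** v : dhom (sh A) A 0).
apply: (@weq_intro _ _ _ boundary (ClosedMor (closed_intro gP)) h1 h2) => W x.
  rewrite boundary_act /= !(actR, De, vu, extR X); abel.
by rewrite boundary_act /= !(actR, De, Dv, su_D, uv, extR X); abel.
Qed.

End Boundary.

(** A map of extensions may ignore the splittings. Its off-diagonal component Q -> A', which is xs'
    e xt, measures this and provides the homotopy. *)
Lemma boundary_nat (A E Q A' E' Q' : B) (i : closed_mor A E) (q : closed_mor E Q)
    (i' : closed_mor A' E') (q' : closed_mor E' Q') (X : split_ext i q) (X' : split_ext i' q')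
    (a : closed_mor A A') (e : closed_mor E E') (c : closed_mor Q Q') :
  (forall W (x : gel W A), e $ i $ x = i' $ a $ x) ->
  (forall W (x : gel W E), c $ q $ x = q' $ e $ x) ->
  (boundary X' : @hom H Q' (T A')) \o (c : @hom H Q Q') ~=
    fmap T (a : @hom H A A') \o (boundary X : @hom H Q (T A)).
Proof.
move=> ei eq; apply/homologousP.
exists (- (su A' ** ((xs X' ** e : dhom E A' 0) ** xt X : dhom Q A' 0))) => W x.
rewrite [X in _ = X - _]cmp_act [X in _ = _ - X]cmp_act /= !boundary_act actN shift_mor_su.
rewrite !(actR, su_D, extR X, ei, extR X') -!eq !(actR, extR X); abel.
Qed.

End Shift.

(** * Suspension *)

Section Suspension.
Variables (B : dg_cat) (sigma : shift_choice B).
Hypothesis preB : pretriangulated B.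

Notation ZB := (cycle_cof_data B).
Notation H := (homology_cat B).
Notation T := (shift_functor sigma).

Lemma cone_of_ext (A : ZB) (K : cone_of A) :
  (exists X : @split_ext B A (cone K) (susp K) (cone_in K) (cone_proj K), True) /\
  @contractible B (cone K).
Proof.
split.
  apply: (quotient_ext preB); first exact: (@cone_cof ZB A K).
  exact: (@cone_quotient ZB A K).
have [Z hZ [w ww]] := cone_contractible K.
exact: weq_zero_contractible hZ ww.
Qed.

Definition cone_ext (A : ZB) (K : cone_of A) :
  @split_ext B A (cone K) (susp K) (cone_in K) (cone_proj K) := sval (cid (cone_of_ext K).1).

Definition susp_theta (A : ZB) (K : cone_of A) : @hom H (susp K) (T A) :=
  boundary sigma (cone_ext K).

Lemma susp_theta_iso (A : ZB) (K : cone_of A) : is_iso (susp_theta K).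
Proof. by apply: boundary_iso; exact: (cone_of_ext K).2. Qed.

Lemma contractible_weq (X Y : B) (w : closed_mor X Y) :
  contractible X -> contractible Y -> dg_weq w.
Proof.
move=> [h1 e1] [h2 e2]; have [z ez] := zero_closed Y X.
apply: (@weq_intro _ _ _ w z (- h1) (- h2)) => W x.
  by rewrite ez !actR -opprD e1 sub0r.
by rewrite ez !actR -opprD e2 sub0r.
Qed.

(** Transporting the contraction gives a null-homotopy of w g, and [h] corrects w g to the
    identity. *)
Lemma weq_contractible (X Y : B) (w : closed_mor X Y) :
  dg_weq w -> contractible X -> contractible Y.
Proof.
move=> /weq_elim [g [_ [h [_ eh]]]] [eta e].
have De W (x : gel W X) : gD (eta $ x) = x - eta $ gD x.
  by rewrite -[x in x - _]e addrK.
exists ((cval w ** eta : dhom X Y 1) ** g - h) => W x.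
rewrite !(actR, De) -[X in _ = X](addrNK (w $ g $ x)) -[x - _]opprB -eh; abel.
Qed.

Lemma contractible_factor (X : B) : exists (D : B) (i : closed_mor X D),
  [/\ dg_cof i, contractible D &
    exists2 Z : cycle_cat B, is_zero_ob Z & exists w : closed_mor D Z, dg_weq w].
Proof.
have [O hO] := zero_ob_exists preB; have [z _] := zero_closed X O.
have [D [i [w [ci ww _]]]] :=
  @cof_weq_factor _ (cofibration_category_cycle preB) X O z.
exists D, i; split=> //; first exact: weq_zero_contractible hO ww.
by exists O => //; exists w.
Qed.

Lemma cone_of_exists (A : ZB) : inhabited (cone_of A).
Proof.
have [D [i [ci cD zD]]] := contractible_factor A.
have [Q [q [X]]] := (cof_ext i).1 ci.
by constructor; apply: (@ConeOf ZB A D i Q q); [| |exact: ext_quotient X].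
Qed.

(** D comes from factoring the map from the pushout CA u_A CE to a zero object. It is contractible,
    like CE, so [s] is a weak equivalence. The maps of quotients exist since [q] kills E. *)
Lemma cone_extension_exists (A E : ZB) (KA : cone_of A) (KE : cone_of E)
    (al : hom A E) :
  exists (D Q : ZB) (al' : hom (cone KA) D) (s : hom (cone KE) D) (q : hom D Q)
    (alq : hom (susp KA) Q) (sq : hom (susp KE) Q),
  [/\ is_cone_extension al al' s, is_quotient (s \o cone_in KE) q,
    alq \o cone_proj KA ~= q \o al' & sq \o cone_proj KE ~= q \o s].
Proof.
have ccB := cofibration_category_cycle preB.
have [P [k [j [po cj _]]]] := cof_pushout ccB (cone_in KE \o al) (cone_cof KA).
have [D [u [cu cD _]]] := contractible_factor P.
pose s : @hom ZB (cone KE) D := (u : @hom ZB P D) \o j.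
pose al' : @hom ZB (cone KA) D := (u : @hom ZB P D) \o k.
have cs : cof s by apply: (cof_cmp ccB).
have ce : is_cone_extension al al' s.
  split=> //.
  - by apply: contractible_weq => //; exact: (cone_of_ext KE).2.
  - by rewrite /al' /s -!cmp_assoc po.1.
  - by exists P, k, j, u; split=> //; split.
clearbody s al'.
have csi : dg_cof (closed_cmp s (cone_in KE)).
  by apply: (dg_cof_cmp preB) => //; exact: (@cone_cof ZB E KE).
have [Q [q [X]]] := (cof_ext _).1 csi.
have desc (A' : ZB) (K : cone_of A') (g : @hom ZB (cone K) D) :
    (forall W (x : gel W (A' : B)), cval q $ cval g $ cval (cone_in K) $ x = 0) ->
    exists g' : @hom ZB (susp K) Q, g' \o cone_proj K ~= (q : @hom ZB D Q) \o g.
  move=> e; pose X' := cone_ext K.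
  pose g' : @dhom B (susp K) Q 0 := (cval q ** cval g : @dhom B (cone K) Q 0) ** xt X'.
  have gP W (x : gel W (susp K : B)) : gD (g' $ x) = g' $ gD x.
    by rewrite !(actR, extR X') e add0r.
  exists (ClosedMor (closed_intro gP)); apply/cycle_eqP => W x.
  rewrite !cmp_act /= !actR (_ : xt X' $ _ = x - cone_in K $ xs X' $ x).
    by rewrite !actR e subr0.
  by rewrite (extR X'); abel.
have qsi W (x : gel W (E : B)) : cval q $ cval s $ cval (cone_in KE) $ x = 0.
  by have := x_qi X x; rewrite closed_cmp_act.
have [sq esq] := desc _ KE s qsi.
have [alq ealq] : exists g' : @hom ZB (susp KA) Q,
    g' \o cone_proj KA ~= (q : @hom ZB D Q) \o al'.
  apply: desc => W x; have [_ _ /cycle_eqP e _] := ce.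
  by have := e W x; rewrite !cmp_act => ->; rewrite qsi.
by exists D, Q, al', s, q, alq, sq; split=> //; apply: ext_quotient X.
Qed.

(** Here [b] is the boundary of E -> D -> Q, invertible as D is contractible. Naturality along [s]
    over the identity and along [al'] over [al] gives the two equations, which express sq^-1 alq
    through the shift of [al]. *)
Lemma cone_extension_boundary (A E D Q : ZB) (KA : cone_of A) (KE : cone_of E)
    (al : hom A E) (al' : hom (cone KA) D) (s : hom (cone KE) D) (q : hom D Q)
    (alq : hom (susp KA) Q) (sq : hom (susp KE) Q) :
  is_cone_extension al al' s -> is_quotient (s \o cone_in KE) q ->
  alq \o cone_proj KA ~= q \o al' -> sq \o cone_proj KE ~= q \o s ->
  exists b : @hom H Q (T E),
  [/\ is_iso b, b \o (sq : @hom H (susp KE) Q) ~= susp_theta KE &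
      b \o (alq : @hom H (susp KA) Q) ~= fmap T (al : @hom H A E) \o susp_theta KA].
Proof.
move=> [cs ws /cycle_eqP eal _] quo /cycle_eqP ealq /cycle_eqP esq.
have csi : dg_cof (closed_cmp s (cone_in KE)).
  by apply: (dg_cof_cmp preB) => //; exact: (@cone_cof ZB E KE).
have [X _] := quotient_ext preB csi quo.
exists (boundary sigma X); split.
- apply: boundary_iso; apply: weq_contractible ws _; exact: (cone_of_ext KE).2.
- apply: (@eqm_trans _ _ _ (fmap T (@idm H E) \o susp_theta KE)).
    apply: (boundary_nat sigma (cone_ext KE) X (a := closed_id E) (e := s)) => W x.
      by rewrite closed_cmp_act id_act.
    by rewrite -cmp_act esq cmp_act.
  by rewrite fmap_id cmp_id_l.
- apply: (boundary_nat sigma (cone_ext KA) X (a := al) (e := al')) => W x.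
    by rewrite closed_cmp_act -cmp_act eal !cmp_act.
  by rewrite -cmp_act ealq cmp_act.
Qed.

Notation F := (ho_functor B).

(** Every morphism of the localization is the image of a closed one, by [ho_ofK], so
    [susp_map_gamma] determines any suspension completely. *)
Lemma suspension_theta (S : suspension ZB) (X Y : ZB) (f : @hom (Ho ZB) X Y) :
  susp_theta (susp_cone S Y) \o fmap F (fmap (susp_functor S) f) ~=
  fmap T (fmap F f) \o susp_theta (susp_cone S X).
Proof.
pose a : @hom ZB X Y := ho_val f.
have [D [Q [al' [s [q [alq [sq [ce quo ea es]]]]]]]] :=
  cone_extension_exists (susp_cone S X) (susp_cone S Y) a.
have [_ eq] := susp_map_gamma ce quo ea es.
have [b [ib bs ba]] := cone_extension_boundary ce quo ea es.
have e : fmap F (fmap (susp_functor S) f) ~= fmap F (susp_map S (fmap gamma a)).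
  by apply: fmap_eqm; apply: (susp_map_eqm S); apply: eqm_sym; apply: ho_ofK.
have {}eq : (sq : @hom H _ Q) \o fmap F (susp_map S (fmap gamma a)) ~= (alq : @hom H _ Q).
  exact: (fmap_eqm F eq).
by rewrite e -bs -cmp_assoc eq ba.
Qed.

(** Sigma f is defined as the conjugate of the shift of f by the comparison isomorphisms.
    Functoriality is then inherited, and the formula on cone extensions follows from
    [cone_extension_boundary]. *)
Lemma suspension_exists : inhabited (suspension ZB).
Proof.
pose K A : cone_of A := inhabited_witness (cone_of_exists A).
have ex X Y (f : @hom (Ho ZB) X Y) : {c : @hom H (susp (K X)) (susp (K Y)) |
    susp_theta (K Y) \o c ~= fmap T (fmap F f) \o susp_theta (K X)}.
  apply: cid; have [t [_ t2]] := susp_theta_iso (K Y).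
  exists (t \o (fmap T (fmap F f) \o susp_theta (K X))).
  by rewrite cmp_assoc t2 cmp_id_l.
pose S X Y (f : @hom (Ho ZB) X Y) : @hom (Ho ZB) (susp (K X)) (susp (K Y)) :=
  ho_of (sval (ex X Y f)).
have SE X Y (f : @hom (Ho ZB) X Y) :
    susp_theta (K Y) \o fmap F (S X Y f) ~= fmap T (fmap F f) \o susp_theta (K X).
  exact: (svalP (ex X Y f)).
have S_inj X Y (f g : @hom (Ho ZB) (susp (K X)) (susp (K Y))) :
    susp_theta (K Y) \o fmap F f ~= susp_theta (K Y) \o fmap F g -> f ~= g.
  by move=> e; apply: (ho_val_inj preB); apply: iso_monic e; apply: susp_theta_iso.
have S1 X Y (f g : @hom (Ho ZB) X Y) : f ~= g -> S X Y f ~= S X Y g.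
  by move=> e; apply: S_inj; rewrite !SE e.
have S2 X : S X X (@idm (Ho ZB) X) ~= @idm (Ho ZB) (susp (K X)).
  by apply: S_inj; rewrite SE !fmap_id cmp_id_l cmp_id_r.
have S3 X Y Z (g : @hom (Ho ZB) Y Z) (f : @hom (Ho ZB) X Y) :
    S X Z (g \o f) ~= S Y Z g \o S X Y f.
  by apply: S_inj; rewrite SE !fmap_cmp cmp_assoc SE -!cmp_assoc SE.
constructor; apply: (@Suspension ZB K S S1 S2 S3).
move=> A E D Q al al' s q alq sq ce quo ea es.
have [b [ib bs ba]] := cone_extension_boundary ce quo ea es.
split.
  have [t [t1 t2]] : @is_iso H _ _ (sq : @hom H (susp (K E)) Q).
    by apply: (is_iso_cancel_l ib); apply: is_iso_eqm (eqm_sym bs) (susp_theta_iso _).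
  by exists (ho_of t); split; apply: (ho_val_inj preB).
apply: (ho_val_inj preB); apply: (iso_monic ib).
apply: (@eqm_trans _ _ _ (susp_theta (K E) \o fmap F (S A E (fmap gamma al)))).
  by rewrite -bs -cmp_assoc.
by rewrite SE ba.
Qed.

Lemma suspension_equivalence (S : suspension ZB) : is_equivalence (susp_functor S).
Proof.
apply: ff_equivalence => [X Y f g e|X Y h|Y].
- apply: (ho_val_inj preB); apply: (@shift_faithful _ sigma).
  apply: (iso_epic (susp_theta_iso (susp_cone S X))).
  rewrite -!(suspension_theta S); apply: cmp_eqm => //.
  exact: (fmap_eqm F e).
- have [t [t1 t2]] := susp_theta_iso (susp_cone S X).
  have [f ef] := shift_full (susp_theta (susp_cone S Y) \o (fmap F h \o t)).
  exists (ho_of f); apply: (ho_val_inj preB).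
  apply: (iso_monic (susp_theta_iso (susp_cone S Y))).
  apply: eqm_trans (suspension_theta S (ho_of f)) _.
  by rewrite ef -!cmp_assoc t1 cmp_id_r.
- have [_ hs _] := preB; have [X [h ih]] := shift_surj sigma (hs Y 1).
  have [t [t1 t2]] := is_iso_cmp (susp_theta_iso (susp_cone S X)) ih.
  exists X, (ho_of (h \o susp_theta (susp_cone S X) : @closed_mor B _ _)), (ho_of t).
  by split; apply: (ho_val_inj preB).
Qed.

Lemma stable_cycle : stable ZB.
Proof.
split; [exact: pointed_cycle | exact: suspension_exists |].
exact: suspension_equivalence.
Qed.

End Suspension.

(** * Triangles *)

Section TriIso.
Variables (C : category) (S : functor C C).

Lemma tri_iso_trans (X Y Z X' Y' Z' X2 Y2 Z2 : C)
    (f : hom X Y) (g : hom Y Z) (h : hom Z (S X))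
    (f' : hom X' Y') (g' : hom Y' Z') (h' : hom Z' (S X'))
    (f2 : hom X2 Y2) (g2 : hom Y2 Z2) (h2 : hom Z2 (S X2)) :
  tri_iso f g h f' g' h' -> tri_iso f' g' h' f2 g2 h2 -> tri_iso f g h f2 g2 h2.
Proof.
move=> [a [b [c [[ia ib ic] [e1 e2 e3]]]]] [a' [b' [c' [[ia' ib' ic'] [e1' e2' e3']]]]].
exists (a' \o a), (b' \o b), (c' \o c); split; first by split; apply: is_iso_cmp.
split.
- by rewrite -cmp_assoc e1 cmp_assoc e1' cmp_assoc.
- by rewrite -cmp_assoc e2 cmp_assoc e2' cmp_assoc.
- by rewrite fmap_cmp -cmp_assoc e3 cmp_assoc e3' cmp_assoc.
Qed.

Lemma tri_iso_eqm (X Y Z : C) (f f' : hom X Y) (g g' : hom Y Z) (h h' : hom Z (S X)) :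
  f ~= f' -> g ~= g' -> h ~= h' -> tri_iso f g h f' g' h'.
Proof.
move=> e1 e2 e3; exists (idm X), (idm Y), (idm Z).
split; first by split; apply: is_iso_id.
split; [| |rewrite fmap_id]; by rewrite cmp_id_l cmp_id_r.
Qed.

End TriIso.

Section Triangles.
Variables (B : dg_cat) (sigma : shift_choice B).
Hypothesis preB : pretriangulated B.

Notation ZB := (cycle_cof_data B).
Notation H := (homology_cat B).
Notation T := (shift_functor sigma).
Notation F := (ho_functor B).

Lemma zero_mor_act (X Y : ZB) (f : hom X Y) :
  is_zero_mor f -> forall W (x : @gel B W X), cval f $ x = 0.
Proof.
move=> [Z [a [b [hZ /cycle_eqP e]]]] W x.
by rewrite e cmp_act (zero_gel (cval a $ x)) ?act0 //; left; case: hZ.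
Qed.

Lemma act_zero_mor (X Y : ZB) (f : hom X Y) :
  (forall W (x : @gel B W X), cval f $ x = 0) -> is_zero_mor f.
Proof.
move=> e; have [O hO] := zero_ob_exists preB.
have [a ea] := zero_closed X O; have [b eb] := zero_closed O Y.
exists O, a, b; split=> //; apply/cycle_eqP => W x.
by rewrite e cmp_act eb.
Qed.

Lemma connecting_exists (A E Q : ZB) (K : cone_of A) (j : hom A E) (q : hom E Q) :
  @split_ext B A E Q j q ->
  exists de : @hom (Ho ZB) Q (susp K), @is_connecting ZB A E Q K j q de.
Proof.
move=> X; have [P [k [l [p0 [Y eY]]]]] := pushout_exists preB (cone_ext preB K) j.
have po := ext_is_pushout eY; have [_ e2 _ _] := eY.
(* Read the other way, the same pushout is an extension of Q by the contractible cone, so its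
   projection [q0] is a weak equivalence. *)
have [q0 [Y2 [_ e2' _ _]]] := pushout_ext preB X (pushout_sym po).
have wq : @weq ZB P Q q0 by apply: (ext_weq_q Y2); exact: (cone_of_ext preB K).2.
exists (loc_cmp (@ho_of B P (susp K) p0) (loc_inv wq)), P, k, l, p0, q0; split=> //.
- split; first by apply/cycle_eqP => W x; rewrite cmp_act e2.
  by apply: act_zero_mor => W x; rewrite cmp_act (x_qi Y).
- split; last by apply/cycle_eqP => W x; rewrite cmp_act e2'.
  by apply: act_zero_mor => W x; rewrite cmp_act (x_qi Y2).
- split; first by exists (loc_inv wq); split; [apply: loc_eq_inv_l | apply: loc_eq_inv_r].
  apply: eqm_trans (eqm_sym (cmp_assoc _ _ _)) _.
  apply: eqm_trans (cmp_id_r _); apply: cmp_eqm => //.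
  exact: loc_eq_inv_l.
Qed.

(* The splitting P -> A of the pushout P = CA u_A E is a null-homotopy of the
   sum of the two boundary maps P -> CA/A -> A and P -> Q -> A; this is the
   source of the sign relating [boundary] and [connecting]. *)
Lemma connecting_theta (A E Q : ZB) (K : cone_of A) (j : hom A E) (q : hom E Q)
    (X : @split_ext B A E Q j q) (de : @hom (Ho ZB) Q (susp K)) :
  @is_connecting ZB A E Q K j q de ->
  susp_theta sigma preB K \o fmap F de ~= (connecting sigma X : @hom H Q (T A)).
Proof.
move=> [P [k [l [p0 [q0 [po [/cycle_eqP pk pl] [qk /cycle_eqP ql] [iq eq]]]]]]].
set XK := cone_ext preB K.
have [pr [Y [e1 e2 e3 e4]]] := pushout_ext preB XK po.
have {}eq : fmap F de \o (q0 : @hom H P Q) ~= (p0 : @hom H P (susp K)).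
  exact: (fmap_eqm F eq).
have iq0 : @is_iso H P Q q0.
  have [t [t1 t2]] := iq; exists (fmap F t).
  split; [exact: (fmap_eqm F t1) | exact: (fmap_eqm F t2)].
have pk' W (x : gel W (cone K : B)) : cval p0 $ cval k $ x = cval (cone_proj K) $ x.
  by rewrite -cmp_act pk.
have ql' W (x : gel W (E : B)) : cval q0 $ cval l $ x = cval q $ x.
  by rewrite -cmp_act ql.
have pl' W (x : gel W (E : B)) : cval p0 $ cval l $ x = 0.
  by rewrite -cmp_act (zero_mor_act pl).
have qk' W (x : gel W (cone K : B)) : cval q0 $ cval k $ x = 0.
  by rewrite -cmp_act (zero_mor_act qk).
have split_P W (x : gel W (P : B)) :
    x = cval l $ xs Y $ x + cval k $ xt XK $ cval pr $ x.
  by rewrite (x_is Y) e3 subrK.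
have p0E W (x : gel W (P : B)) : cval p0 $ x = cval pr $ x.
  by rewrite [x in LHS]split_P actD pl' pk' (extR XK) add0r.
have q0E W (x : gel W (P : B)) : cval q0 $ x = cval q $ xs Y $ x.
  by rewrite [x in LHS]split_P actD ql' qk' addr0.
apply: (iso_epic iq0); rewrite -cmp_assoc eq.
apply/homologousP; exists (- (su sigma A ** (xs X ** xs Y : dhom P A 0))) => W x.
rewrite [X in _ = X - _]cmp_act [X in _ = _ - X]cmp_act.
rewrite [susp_theta _ _ _ $ _]boundary_act connecting_act p0E q0E.
rewrite !(actR, su_D, extR X, extR Y, e1); abel.
Qed.

(** The comparison from the cone of [j] to Q is q rho. Its inverse is the section i xt, made closed
    by subtracting u xphi. *)
Lemma ext_cone_triangle (A E Q : B) (j : closed_mor A E) (q : closed_mor E Q)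
    (X : split_ext j q) :
  exists (r : representation (cone_module j)) (i : closed_mor E (rep_ob r))
    (pbar : closed_mor (rep_ob r) (sh sigma A)),
    is_cone_triangle i pbar /\
    @tri_iso H T A E (rep_ob r) A E Q j i pbar j q (connecting sigma X).
Proof.
have [_ _ /(_ _ _ j) [r]] := preB.
have [i [p [ei ep [K]]]] := cone_rep_exists r.
pose pb : dhom (rep_ob r) (sh sigma A) 0 := dcmp (esym (subrr 1)) (su sigma A) p.
have pbP W (x : gel W (rep_ob r)) : gD (pb $ x) = pb $ gD x.
  by rewrite !(actR, su_D, coneR K) opprK.
exists r, i, (ClosedMor (closed_intro pbP)); split.
  by split=> //; exists p; split=> //.
pose c : dhom (rep_ob r) Q 0 := cval q ** c_rho K.
have cP W (x : gel W (rep_ob r)) : gD (c $ x) = c $ gD x.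
  by rewrite !(actR, coneR K, extR X) add0r.
pose d : dhom Q (rep_ob r) 0 := cval i ** xt X - c_u K ** xphi X.
have dP W (x : gel W Q) : gD (d $ x) = d $ gD x.
  by rewrite !(actR, coneR K, extR X); abel.
exists (@idm H A), (@idm H E), (ClosedMor (closed_intro cP)).
split; first split; try exact: is_iso_id.
  pose h : dhom (rep_ob r) (rep_ob r) 1 := - (c_u K ** (xs X ** c_rho K : dhom _ A 0)).
  apply: (@weq_intro _ _ _ _ (ClosedMor (closed_intro dP)) h 0) => W x /=.
    by rewrite !(actR, coneR K, extR X); abel.
  by rewrite !(actR, coneR K, extR X); abel.
split.
- by rewrite cmp_id_l cmp_id_r.
- rewrite cmp_id_r; apply: homology_eqm; apply/cycle_eqP => W x.
  by rewrite cmp_act /= !(actR, coneR K).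
- rewrite fmap_id cmp_id_l; apply/homologousP.
  exists (- (su sigma A ** (xs X ** c_rho K : dhom _ A 0))) => W x.
  rewrite [X in _ = _ - X]cmp_act connecting_act /= !(actR, su_D, coneR K, extR X); abel.
Qed.

(** With [factor_cone], the extension has [xphi] equal to [p], so [connecting] is [pbar] on the
    nose. *)
Lemma cone_triangle_ext (A D : B) (f : closed_mor A D)
    (r : representation (cone_module f)) (i : closed_mor D (rep_ob r))
    (pbar : closed_mor (rep_ob r) (sh sigma A)) :
  is_cone_triangle i pbar ->
  exists (E : B) (j : closed_mor A E) (q : closed_mor E (rep_ob r)) (X : split_ext j q),
    @tri_iso H T A E (rep_ob r) A D (rep_ob r) j q (connecting sigma X) f i pbar.
Proof.
move=> [ei [p [ep epb]]]; have [K] := cone_rep_data ei ep.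
have [E [j [q [w [X [wj ww Xp iw]]]]]] := factor_cone preB K.
exists E, j, q, X, (@idm H A), w, (@idm H (rep_ob r)).
split; first by split=> //; apply: is_iso_id.
split.
- rewrite cmp_id_r; apply: homology_eqm; apply/cycle_eqP => W x.
  by rewrite cmp_act wj.
- by rewrite cmp_id_l; apply: eqm_sym.
- rewrite fmap_id cmp_id_l cmp_id_r; apply: homology_eqm; apply/cycle_eqP => W x.
  by rewrite connecting_act Xp epb cmpact.
Qed.

Variable S : suspension ZB.

Definition tau : nat_iso (functor_comp F (susp_functor S)) (functor_comp T F) :=
  @NatIso _ _ (functor_comp F (susp_functor S)) (functor_comp T F)
    (fun A => susp_theta sigma preB (susp_cone S A))
    (fun A => susp_theta_iso sigma preB (susp_cone S A))
    (fun A E f => @suspension_theta B sigma preB S A E f).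

Lemma dist_tri_iso (X Y Z X' Y' Z' : H) (f : hom X Y) (g : hom Y Z) (h : hom Z (T X))
    (f' : hom X' Y') (g' : hom Y' Z') (h' : hom Z' (T X')) :
  @tri_iso H T X Y Z X' Y' Z' f g h f' g' h' ->
  @dist (homology_tri sigma) X Y Z f g h -> @dist (homology_tri sigma) X' Y' Z' f' g' h'.
Proof.
move=> e [A [D [f0 [r [i [pbar [ct e']]]]]]].
by exists A, D, f0, r, i, pbar; split=> //; apply: tri_iso_trans e' e.
Qed.

Lemma ho_tri_iso (X Y Z X' Y' Z' : Ho ZB)
    (f : hom X Y) (g : hom Y Z) (h : hom Z (susp_functor S X))
    (f' : hom X' Y') (g' : hom Y' Z') (h' : hom Z' (susp_functor S X')) :
  @tri_iso (Ho ZB) (susp_functor S) X Y Z X' Y' Z' f g h f' g' h' <->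
  @tri_iso H T X Y Z X' Y' Z' (fmap F f) (fmap F g) (tau X \o fmap F h)
    (fmap F f') (fmap F g') (tau X' \o fmap F h').
Proof.
have isoF U V (a : @hom (Ho ZB) U V) : is_iso a -> is_iso (fmap F a).
  move=> [b [b1 b2]]; exists (fmap F b).
  by split; [apply: (fmap_eqm F b1) | apply: (fmap_eqm F b2)].
have isoG (U V : Ho ZB) (a : @hom H U V) : is_iso a -> @is_iso (Ho ZB) U V (ho_of a).
  by move=> [b [b1 b2]]; exists (ho_of b); split; apply: (ho_val_inj preB).
split=> -[a [b [c [[ia ib ic] [e1 e2 e3]]]]].
- exists (fmap F a), (fmap F b), (fmap F c); split; first by split; apply: isoF.
  split; [exact: (fmap_eqm F e1) | exact: (fmap_eqm F e2) |].
  rewrite cmp_assoc -(nt_nat tau a) -cmp_assoc -[in X in _ ~= X]cmp_assoc.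
  by apply: cmp_eqm => //; apply: (fmap_eqm F e3).
- exists (ho_of a), (ho_of b), (ho_of c); split; first by split; apply: isoG.
  split; apply: (ho_val_inj preB); [exact: e1 | exact: e2 |].
  apply: (iso_monic (nt_iso tau X')).
  apply: eqm_trans (cmp_assoc _ _ _) _.
  apply: eqm_trans (cmp_eqm (nt_nat tau (ho_of a)) (eqm_refl _)) _.
  apply: eqm_trans (eqm_sym (cmp_assoc _ _ _)) _.
  apply: eqm_trans e3 _; exact: eqm_sym (cmp_assoc _ _ _).
Qed.

Lemma dist_ho_functor (X Y Z : Ho ZB) (f : hom X Y) (g : hom Y Z)
    (h : hom Z (susp_functor S X)) :
  @dist (Ho_tri S) X Y Z f g h <->
  @dist (homology_tri sigma) X Y Z (fmap F f) (fmap F g) (tau X \o fmap F h).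
Proof.
split.
- move=> [A [E [Q [j [q [de [cj qj hde /ho_tri_iso e]]]]]]].
  have [Xt _] := quotient_ext preB cj qj.
  apply: dist_tri_iso e _.
  have [r [i [pbar [ct e']]]] := ext_cone_triangle Xt.
  exists A, E, j, r, i, pbar; split=> //; apply: tri_iso_trans e' _.
  by apply: tri_iso_eqm => //; apply: eqm_sym; apply: connecting_theta.
- move=> [A [D [f0 [r [i [pbar [ct e]]]]]]].
  have [E [j [q [Xt e']]]] := cone_triangle_ext ct.
  have [de hde] := @connecting_exists A E (rep_ob r) (susp_cone S A) j q Xt.
  exists A, E, (rep_ob r), j, q, de; split=> //.
  + by apply/cof_ext; exists (rep_ob r), q.
  + exact: (ext_quotient preB Xt).
  + apply/ho_tri_iso; apply: tri_iso_trans e; apply: tri_iso_trans e'.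
    by apply: tri_iso_eqm => //; apply: connecting_theta.
Qed.

Lemma ho_tri_equivalent : tri_equivalent (Ho_tri S) (homology_tri sigma).
Proof.
exists F; first exact: ho_functor_equivalence.
by exists tau => X Y Z f g h; apply: dist_ho_functor.
Qed.

(** The direction used for algebraic categories: the inverse functor is again the identity on
    objects, with the inverses of [tau] as its structure isomorphisms. *)
Lemma homology_tri_equivalent : tri_equivalent (homology_tri sigma) (Ho_tri S).
Proof.
pose G := ho_inverse preB.
pose t := fun X : H => (sval (cid (nt_iso tau X)) : @hom H (T X) (susp_functor S X)).
have ht (X : H) : are_inverse (tau X) (t X) by exact: svalP (cid (nt_iso tau X)).
have isot (X : H) : is_iso (ho_of (t X)).
  exists (ho_of (tau X : @closed_mor B _ _)).
  by split; apply: (ho_val_inj preB); have [] := ht X.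
have natt (X Y : H) (f : hom X Y) :
    ho_of (t Y) \o fmap (functor_comp G T) f ~=
    fmap (functor_comp (susp_functor S) G) f \o ho_of (t X).
  apply: (ho_val_inj preB); apply: (iso_monic (nt_iso tau Y)).
  apply: (iso_epic (nt_iso tau X)).
  have e1 : tau Y \o t Y ~= idm _ := (ht Y).2.
  have e2 : t X \o tau X ~= idm _ := (ht X).1.
  have e3 := nt_nat tau (ho_of f).
  apply: (@eqm_trans _ _ _ (fmap T f \o tau X)).
    by apply: cmp_eqm => //; rewrite -[fmap T f in X in _ ~= X]cmp_id_l -e1 -cmp_assoc.
  apply: eqm_trans (eqm_sym e3) _.
  apply: (eqm_trans _ (cmp_assoc _ _ _)).
  apply: cmp_eqm => //.
  by rewrite -[X in X ~= _]cmp_id_r -e2 cmp_assoc.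
pose t' := @NatIso _ _ (functor_comp G T) (functor_comp (susp_functor S) G)
  (fun X => ho_of (t X)) isot natt.
exists G; first exact: ho_inverse_equivalence.
exists t' => X Y Z f g h; split=> d.
  apply/dist_ho_functor; apply: dist_tri_iso d; apply: tri_iso_eqm => //.
  by rewrite -[X in X ~= _]cmp_id_l -(ht X).2 -cmp_assoc.
move/dist_ho_functor: d => d; apply: dist_tri_iso d; apply: tri_iso_eqm => //.
by rewrite -[X in _ ~= X]cmp_id_l -(ht X).2 -cmp_assoc.
Qed.

End Triangles.

(** * Composition of triangulated equivalences and the final statement *)

Lemma fmap_iso (C D : category) (F : functor C D) (X Y : C) (f : hom X Y) :
  is_iso f -> is_iso (fmap F f).
Proof.
by move=> [g [e1 e2]]; exists (fmap F g); split; rewrite -fmap_cmp ?e1 ?e2 fmap_id.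
Qed.

Lemma equivalence_comp (C D E : category) (G : functor D E) (F : functor C D) :
  is_equivalence G -> is_equivalence F -> is_equivalence (functor_comp G F).
Proof.
move=> [G' [[a] [b]]] [F' [[a'] [b']]]; exists (functor_comp F' G').
split; constructor.
- apply: (@NatIso _ _ (functor_comp (functor_comp F' G') (functor_comp G F))
      (functor_id C) (fun X => a' X \o fmap F' (a (F X)))).
    move=> X; apply: is_iso_cmp; last exact: nt_iso.
    exact: (fmap_iso F' (nt_iso a (F X))).
  move=> X Y f /=; rewrite -cmp_assoc -fmap_cmp.
  have /= -> := nt_nat a (fmap F f).
  rewrite fmap_cmp !cmp_assoc.
  by have /= -> := nt_nat a' f.
- apply: (@NatIso _ _ (functor_comp (functor_comp G F) (functor_comp F' G'))
      (functor_id E) (fun X => b X \o fmap G (b' (G' X)))).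
    move=> X; apply: is_iso_cmp; last exact: nt_iso.
    exact: (fmap_iso G (nt_iso b' (G' X))).
  move=> X Y f /=; rewrite -cmp_assoc -fmap_cmp.
  have /= -> := nt_nat b' (fmap G' f).
  rewrite fmap_cmp !cmp_assoc.
  by have /= -> := nt_nat b f.
Qed.

(** The structure isomorphism of the composite yields third maps that agree with the required ones
    only up to [~=], and [tri_data] does not ask [dist] to respect this relation; hence the first
    hypothesis. *)
Lemma tri_equivalent_trans (T1 T2 T3 : tri_data) :
  (forall (X Y Z : T3) (f : hom X Y) (g : hom Y Z) (h h' : hom Z (shift X)),
     h ~= h' -> dist f g h -> dist f g h') ->
  tri_equivalent T1 T2 -> tri_equivalent T2 T3 -> tri_equivalent T1 T3.
Proof.
move=> resp [F eqF [tau dF]] [G eqG [rho dG]].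
exists (functor_comp G F); first exact: equivalence_comp.
pose t (X : T1) := rho (F X) \o fmap G (tau X).
have isot (X : T1) : is_iso (t X).
  apply: is_iso_cmp; last exact: nt_iso.
  exact: (fmap_iso G (nt_iso tau X)).
have natt (X Y : T1) (f : hom X Y) :
    t Y \o fmap (functor_comp (functor_comp G F) shift) f ~=
    fmap (functor_comp shift (functor_comp G F)) f \o t X.
  rewrite /t /= -cmp_assoc -fmap_cmp.
  have /= -> := nt_nat tau f.
  rewrite fmap_cmp !cmp_assoc.
  by have /= -> := nt_nat rho (fmap F f).
exists (@NatIso _ _ (functor_comp (functor_comp G F) shift)
  (functor_comp shift (functor_comp G F)) t isot natt) => X Y Z f g h /=.
have e : rho (F X) \o fmap G (tau X \o fmap F h) ~= t X \o fmap G (fmap F h).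
  by rewrite /t fmap_cmp cmp_assoc.
split=> [/dF /dG|d]; first exact: resp.
by apply/dF; apply/dG; apply: resp d; apply: eqm_sym.
Qed.

Theorem proposition3p2 :
  (forall B : dg_cat, pretriangulated B ->
     [/\ cofibration_category (cycle_cof_data B),
         stable (cycle_cof_data B),
         forall X : cycle_cof_data B, fibrant X &
         forall (S : suspension (cycle_cof_data B)) (sigma : shift_choice B),
           tri_equivalent (Ho_tri S) (homology_tri sigma)]) /\
  (forall T : tri_data, triangulated T -> algebraic T -> topological T).
Proof.
have sig B : pretriangulated B -> inhabited (shift_choice B).
  by move=> [_ hs _]; constructor=> X; apply: inhabited_witness; apply: hs.
split=> [B preB|T _ [B [sigma [preB eT]]]].
  (* Stability is proved by comparison with the shift, so objects X[1] have to be chosen even though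
     its statement does not mention them. *)
  have [s] := sig B preB; split.
  - exact: cofibration_category_cycle.
  - exact: (stable_cycle s).
  - exact: fibrant_cycle.
  - by move=> S sigma; apply: ho_tri_equivalent.
have stB := stable_cycle sigma preB; have [_ [S] _] := stB.
exists (cycle_cof_data B), S; split=> //; first exact: cofibration_category_cycle.
apply: tri_equivalent_trans eT (homology_tri_equivalent sigma preB S).
move=> X Y Z f g h h' e [A [D [Q [j [q [de [cj qj hde tj]]]]]]].
exists A, D, Q, j, q, de; split=> //.
by apply: tri_iso_trans tj _; apply: tri_iso_eqm.
Qed.
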